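(* There exist absolute constants $C,c,c'>0$ such that, setting $\varepsilon_0 = c^2/c'$, $\zeta_1(\delta) = C\sqrt{\delta}$ and $\zeta_2(\delta) = 1/\sqrt{c-\sqrt{c'\delta}}$, the following holds. Let $d\geq1$, $L\geq 2$, $p\in[1,\infty]$, $p'\in[1,\infty]$ with $\frac1p+\frac1{p'}=1$. Let $f:\mathbb{R}^d\to\mathbb{R}^L$ be a linear $L$-class classifier, $f_l(\boldsymbol{z}) = \boldsymbol{w}_l^T\boldsymbol{z}+\boldsymbol{b}_l$ for $l=1,\dots,L$, with predicted label $g(\boldsymbol{z}) = \operatorname{argmax}_l f_l(\boldsymbol{z})$. Let $\boldsymbol{x}\in\mathbb{R}^d$, $k = g(\boldsymbol{x})$, assume $\boldsymbol{w}_l\neq\boldsymbol{w}_k$ for all $l\neq k$ and $\|\boldsymbol{r}^*_p(\boldsymbol{x})\|_p>0$. Let $j$ be a class such that $\boldsymbol{x}+\boldsymbol{r}^*_p(\boldsymbol{x})$ lies on the decision boundary between classes $k$ and $j$, and let $j' \in \operatorname{argmin}_{l\neq k}\frac{\|\boldsymbol{w}_k-\boldsymbol{w}_l\|_{p'}}{\|\boldsymbol{w}_k-\boldsymbol{w}_l\|_2}$. Then for every $0<\varepsilon<\varepsilon_0$, \[ \zeta_1\!\left(\frac{\varepsilon}{L-1}\right) d^{1/p}\frac{\|\boldsymbol{w}_k-\boldsymbol{w}_{j'}\|_{p'}}{\|\boldsymbol{w}_k-\boldsymbol{w}_{j'}\|_2} \leq \frac{r_{p,\varepsilon}(\boldsymbol{x})}{\|\boldsymbol{r}^*_p(\boldsymbol{x})\|_p}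 \leq \zeta_2(\varepsilon)\, d^{1/p}\frac{\|\boldsymbol{w}_k-\boldsymbol{w}_j\|_{p'}}{\|\boldsymbol{w}_k-\boldsymbol{w}_j\|_2}. \]
   Context: $\mathcal{B}_p = \{\boldsymbol{z}\in\mathbb{R}^d : \|\boldsymbol{z}\|_p\leq1\}$ and $\boldsymbol{v}$ is uniformly distributed on $\mathcal{B}_p$. $r_{p,\varepsilon}(\boldsymbol{x}) = \inf\{|\alpha| : \alpha\in\mathbb{R},\ \mathbb{P}_{\boldsymbol{v}}\{g(\boldsymbol{x}+\alpha\boldsymbol{v})\neq g(\boldsymbol{x})\}\geq\varepsilon\}$ ($\inf\emptyset=+\infty$). $\boldsymbol{r}^*_p(\boldsymbol{x})$ is a minimizer of $\|\boldsymbol{r}\|_p$ subject to $g(\boldsymbol{x}+\boldsymbol{r})\neq g(\boldsymbol{x})$ (minimal $\ell_p$ perturbation changing the label). Here $d^{1/\infty}=1$. *)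

(* Defs.v *)
From HB Require Import structures.
From mathcomp Require Import all_boot all_order all_algebra.
From mathcomp Require Import all_classical all_reals all_analysis.
Set Implicit Arguments. Unset Strict Implicit. Unset Printing Implicit Defensive.
Import Order.TTheory GRing.Theory Num.Theory.
Local Open Scope classical_set_scope.
Local Open Scope ring_scope.

Section Defs.
Variable R : realType.

Definition vcons (n : nat) (t : R) (z : 'I_n -> R) : 'I_n.+1 -> R :=
  fun i => match unlift ord0 i with None => t | Some j => z j end.

(* iterated Lebesgue integral over R^n (Tonelli), used to define the
   n-dimensional Lebesgue measure *)
Fixpoint iint (n : nat) : (('I_n -> R) -> \bar R) -> \bar R :=
  match n as m return (('I_m -> R) -> \bar R) -> \bar R with
  | 0 => fun f => f (fun _ => 0)
  | n'.+1 => fun f =>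
      (\int[@lebesgue_measure R]_t iint (fun z => f (vcons t z)))%E
  end.

Definition vol (d : nat) (A : set 'rV[R]_d) : \bar R :=
  iint (fun z : 'I_d -> R => (\1_A (\row_i z i) : R)%:E).

(* l_p norm, p in [1, +oo] (value irrelevant for p = -oo) *)
Definition lpnorm (d : nat) (p : \bar R) (z : 'rV[R]_d) : R :=
  match p with
  | EFin q => powR (\sum_i `|z ord0 i| `^ q) q^-1
  | +oo%E => \big[Num.max/0]_i `|z ord0 i|
  | -oo%E => 0
  end.

Definition dpow (d : nat) (p : \bar R) : R :=
  match p with EFin q => powR d%:R q^-1 | _ => 1 end.

Definition conj_exp (p p' : \bar R) : Prop :=
  match p, p' with
  | EFin a, EFin b => a != 0 /\ b != 0 /\ a^-1 + b^-1 = 1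
  | EFin a, +oo%E => a^-1 = 1
  | +oo%E, EFin b => b^-1 = 1
  | _, _ => False
  end.

Definition lin_f (d L : nat) (w : 'I_L -> 'rV[R]_d) (b : 'I_L -> R)
  (l : 'I_L) (z : 'rV[R]_d) : R := \sum_i w l ord0 i * z ord0 i + b l.

(* g(z) is an argmax of l |-> f_l(z) (ties broken arbitrarily) *)
Definition is_argmax_label (d L : nat) (w : 'I_L -> 'rV[R]_d) (b : 'I_L -> R)
  (g : 'rV[R]_d -> 'I_L) : Prop :=
  forall z l, lin_f w b l z <= lin_f w b (g z) z.

Definition is_min_pert (d L : nat) (p : \bar R) (g : 'rV[R]_d -> 'I_L)
  (x r : 'rV[R]_d) : Prop :=
  g (x + r) != g x /\
  forall r', g (x + r') != g x -> lpnorm p r <= lpnorm p r'.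

Definition on_boundary (d L : nat) (w : 'I_L -> 'rV[R]_d) (b : 'I_L -> R)
  (k j : 'I_L) (z : 'rV[R]_d) : Prop :=
  lin_f w b k z = lin_f w b j z /\ forall l, lin_f w b l z <= lin_f w b k z.

Definition lpball (d : nat) (p : \bar R) : set 'rV[R]_d :=
  [set z | lpnorm p z <= 1].

(* P_v{ g(x + alpha v) <> g(x) }, v uniform on the l_p unit ball *)
Definition flip_prob (d L : nat) (p : \bar R) (g : 'rV[R]_d -> 'I_L)
  (x : 'rV[R]_d) (alpha : R) : R :=
  fine (vol (@lpball d p `&` [set v | g (x + alpha *: v) != g x]))
  / fine (vol (@lpball d p)).

(* r_{p,eps}(x) = inf { |alpha| : P_v{...} >= eps }, inf of empty = +oo *)
Definition r_eps (d L : nat) (p : \bar R) (g : 'rV[R]_d -> 'I_L)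
  (x : 'rV[R]_d) (eps : R) : \bar R :=
  ereal_inf [set (`|alpha|)%:E | alpha in [set a | eps <= flip_prob p g x a]].

Definition wratio (d L : nat) (p' : \bar R) (w : 'I_L -> 'rV[R]_d)
  (k l : 'I_L) : R :=
  lpnorm p' (w k - w l) / lpnorm 2%:E (w k - w l).

End Defs.

(* Main.v *)
(* For the linear classifier, g changes its label only where some margin
   f_k - f_l changes sign, and by duality of the norms the margins at x satisfy
   f_k(x) - f_l(x) >= |w_k - w_l|_p' |r*|_p for every l <> k, with equality for
   l = j.  Everything thus reduces to two-sided tail bounds for u.v with v uniform
   on the unit ball: Chebyshev's inequality and a union bound over l <> k give the
   lower estimate, the Paley-Zygmund inequality for (u.v)^2 gives the upper one.

   Both need E v_i^2 and E v_i^4 to be of order a^2 and a^4, with a = d^(-1/p),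
   uniformly in d and p.  The slice of the ball at v_i = t is a ball of radius
   (1 - |t|^p)^(1/p) in dimension d - 1; relative to the unit ball its volume is
   at least e^-1 for |t| <= a and, because 1 - s <= e^-s, at most
   e^(1/2) e^(-|t|/(2a)) for every t.  The mixed moments vanish or are controlled
   through the symmetry of the ball under coordinate reflections.

   The label g is arbitrary on ties, so the flip event need not be measurable;
   it is only ever compared with measurable events, using that the integral of
   nonnegative functions is monotone without any measurability assumption. *)

Require Import Defs.
From HB Require Import structures.
From mathcomp Require Import all_boot all_order all_algebra.
From mathcomp Require Import all_classical all_reals all_analysis.
From mathcomp Require Import measurable_realfun.
From mathcomp Require Import ring lra.
Import Order.TTheory GRing.Theory Num.Theory.
Local Open Scope classical_set_scope.
Local Open Scope ring_scope.
Set Implicit Arguments.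
Unset Strict Implicit.
Unset Printing Implicit Defensive.

(** * Iterated Lebesgue integrals *)

Section IteratedIntegral.
Variable R : realType.
Local Notation mu := (@lebesgue_measure R).
Local Notation Rm := (measurableTypeR R).

Definition vinsert (n : nat) (i : 'I_n.+1) (t : R) (z : 'I_n -> R) : 'I_n.+1 -> R :=
  fun k => if unlift i k is Some j then z j else t.

(* ['I_n -> R] carries no measurable structure; the one of tuples is used instead. *)
Definition vmeasurable (n : nat) (f : ('I_n -> R) -> \bar R) :=
  measurable_fun setT (fun z : n.-tuple Rm => f (tnth z)).

Lemma vcons_tnth n (t : R) (z : n.-tuple Rm) :
  vcons t (tnth z) = tnth [tuple of t :: z].
Proof.
apply/funext => k; rewrite /vcons; case: unliftP => [j ->|->].
  by rewrite tnthS.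
by rewrite tnth0.
Qed.

Lemma iint_ge0 n (f : ('I_n -> R) -> \bar R) :
  (forall z, 0 <= f z)%E -> (0 <= iint f)%E.
Proof.
elim: n f => [|n IH] f f0 /=; first exact: f0.
by apply: integral_ge0 => t _; apply: IH => z; apply: f0.
Qed.

(* No measurability is needed: the integral of a nonnegative function is a
   supremum over the simple functions below it. *)
Lemma le_integral_ge0 (f g : Rm -> \bar R) : (forall t, 0 <= f t)%E ->
  (forall t, f t <= g t)%E -> (\int[mu]_t f t <= \int[mu]_t g t)%E.
Proof.
move=> f0 fg; rewrite !ge0_integralTE//; last first.
  by move=> t; apply: le_trans (fg t).
apply: le_ereal_sup => _ [h hf <-]; exists h => // t.
exact: le_trans (hf t) (fg t).
Qed.

Lemma le_iint n (f g : ('I_n -> R) -> \bar R) : (forall z, 0 <= f z)%E ->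
  (forall z, f z <= g z)%E -> (iint f <= iint g)%E.
Proof.
elim: n f g => [|n IH] f g f0 fg /=; first exact: fg.
apply: le_integral_ge0 => t; first exact: iint_ge0.
by apply: IH => z.
Qed.

(** The parameter space [T] is arbitrary so that the induction can absorb the first coordinate into
    it: the induction hypothesis is applied over [T * Rm], and Tonelli's theorem then integrates
    that coordinate out. *)
Lemma measurable_iint n d (T : measurableType d) (f : T -> ('I_n -> R) -> \bar R) :
  (forall t z, 0 <= f t z)%E ->
  measurable_fun setT (fun x : T * n.-tuple Rm => f x.1 (tnth x.2)) ->
  measurable_fun setT (fun t => iint (f t)).
Proof.
elim: n d T f => [|n IH] d T f f0 mf /=.
  pose e := [tuple] : 0.-tuple Rm.
  rewrite [X in measurable_fun _ X](_ : _ = (fun x : T * 0.-tuple Rm => f x.1 (tnth x.2)) \o (fun t => (t, e))); last first.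
    by apply/funext => t /=; congr f; apply/funext => -[].
  apply: measurableT_comp => //.
pose F (x : T * Rm) := iint (fun z => f x.1 (vcons x.2 z)).
apply: (measurable_fun_fubini_tonelli_F (m2 := mu) F) => [|x]; last exact: iint_ge0.
apply: IH => // .
rewrite [X in measurable_fun _ X](_ : _ = (fun x : T * n.+1.-tuple Rm => f x.1 (tnth x.2)) \o
  (fun x : (T * Rm) * n.-tuple Rm => (x.1.1, [tuple of x.1.2 :: x.2] : n.+1.-tuple Rm))); last first.
  by apply/funext => x /=; rewrite vcons_tnth.
apply: measurableT_comp => //.
apply/measurable_fun_pairP; split => /=.
  exact: (measurableT_comp measurable_fst measurable_fst).
by apply: measurable_cons => //; exact: measurableT_comp.
Qed.

Lemma vmeasurable_vcons n (f : ('I_n.+1 -> R) -> \bar R) : vmeasurable f ->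
  measurable_fun setT (fun x : Rm * n.-tuple Rm => f (vcons x.1 (tnth x.2))).
Proof.
move=> mf.
rewrite [X in measurable_fun _ X](_ : _ = (fun z : n.+1.-tuple Rm => f (tnth z)) \o
  (fun x : Rm * n.-tuple Rm => [tuple of x.1 :: x.2] : n.+1.-tuple Rm)); last first.
  by apply/funext => x /=; rewrite vcons_tnth.
by apply: measurableT_comp => //; exact: measurable_cons.
Qed.

Lemma vmeasurable_slice n (f : ('I_n.+1 -> R) -> \bar R) (t : R) :
  vmeasurable f -> vmeasurable (fun z => f (vcons t z)).
Proof.
move=> /vmeasurable_vcons mf.
exact: (measurableT_comp mf (pair1_measurable t)).
Qed.

Lemma measurable_iint_slice n (f : ('I_n.+1 -> R) -> \bar R) :
  (forall z, 0 <= f z)%E -> vmeasurable f ->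
  measurable_fun setT (fun t : Rm => iint (fun z => f (vcons t z))).
Proof.
by move=> f0 mf; apply: measurable_iint => //; exact: vmeasurable_vcons.
Qed.

Lemma iintD n (f g : ('I_n -> R) -> \bar R) :
  (forall z, 0 <= f z)%E -> vmeasurable f ->
  (forall z, 0 <= g z)%E -> vmeasurable g ->
  iint (fun z => f z + g z)%E = (iint f + iint g)%E.
Proof.
elim: n f g => [|n IH] f g f0 mf g0 mg //=.
rewrite -ge0_integralD//; last 4 first.
- by move=> t _; apply: iint_ge0.
- exact: measurable_iint_slice.
- by move=> t _; apply: iint_ge0.
- exact: measurable_iint_slice.
by apply: eq_integral => t _; rewrite IH//; exact: vmeasurable_slice.
Qed.

Lemma iintZ n (f : ('I_n -> R) -> \bar R) (c : R) : 0 <= c ->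
  (forall z, 0 <= f z)%E -> vmeasurable f ->
  iint (fun z => c%:E * f z)%E = (c%:E * iint f)%E.
Proof.
move=> c0; elim: n f => [|n IH] f f0 mf //=.
rewrite -ge0_integralZl//; last 2 first.
- exact: measurable_iint_slice.
- by move=> t _; apply: iint_ge0.
by apply: eq_integral => t _; rewrite IH//; exact: vmeasurable_slice.
Qed.

Lemma vinsert0 n (t : R) (z : 'I_n -> R) : vinsert ord0 t z = vcons t z.
Proof. by apply/funext => k; rewrite /vinsert /vcons; case: unlift. Qed.

Lemma vinsert_lift n (i : 'I_n.+1) (t s : R) (z : 'I_n -> R) :
  vinsert (lift ord0 i) t (vcons s z) = vcons s (vinsert i t z).
Proof.
apply/funext => k; rewrite /vinsert /vcons.
case: (unliftP ord0 k) => [j ->|->].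
  case: (unliftP i j) => [l ->|->].
    rewrite (_ : lift ord0 (lift i l) = lift (lift ord0 i) (lift ord0 l)); last first.
      by apply/val_inj; rewrite /= /bump /= !add1n ltnS addnS.
    by rewrite liftK liftK.
  by rewrite unlift_none.
rewrite (_ : ord0 = lift (lift ord0 i) ord0); last by apply/val_inj.
rewrite liftK /=; case: unliftP => //= j.
Qed.

Lemma vmeasurable_vinsert n (i : 'I_n.+1) (f : ('I_n.+1 -> R) -> \bar R) :
  vmeasurable f ->
  measurable_fun setT (fun x : Rm * n.-tuple Rm => f (vinsert i x.1 (tnth x.2))).
Proof.
move=> mf.
pose h (x : Rm * n.-tuple Rm) : n.+1.-tuple Rm := [tuple vinsert i x.1 (tnth x.2) k | k < n.+1].
rewrite [X in measurable_fun _ X](_ : _ = (fun z : n.+1.-tuple Rm => f (tnth z)) \o h); last first.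
  by apply/funext => x /=; congr f; apply/funext => k; rewrite tnth_mktuple.
apply: measurableT_comp => //.
apply/measurable_fun_tnthP => k.
rewrite (_ : _ \o _ = (fun x => vinsert i x.1 (tnth x.2) k)); last first.
  by apply/funext => x /=; rewrite tnth_mktuple.
rewrite /vinsert; case: (unlift i k) => [j|]; last exact: measurable_fst.
exact: (measurableT_comp (measurable_tnth j) measurable_snd).
Qed.

(** By Tonelli any coordinate, not only the first, may be the outermost variable. The induction
    hypothesis brings coordinate [i] to the second place, and exchanging the two outer integrals
    brings it to the first. *)
Lemma iint_vinsert n (i : 'I_n.+1) (f : ('I_n.+1 -> R) -> \bar R) :
  (forall z, 0 <= f z)%E -> vmeasurable f ->
  iint f = (\int[mu]_t iint (fun z => f (vinsert i t z)))%E.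
Proof.
elim: n i f => [|n IH] i f f0 mf.
  rewrite /=; apply: eq_integral => t _; congr f.
  by rewrite (ord1 i) vinsert0.
case: (unliftP ord0 i) => [j ->|->]; last first.
  by rewrite /=; apply: eq_integral => t _; congr integral; apply/funext => s; congr iint; apply/funext => z; rewrite vinsert0.
transitivity (\int[mu]_s \int[mu]_t iint (fun z => f (vcons s (vinsert j t z))))%E.
  apply: eq_integral => s _; apply: (IH j (fun z => f (vcons s z))) => //.
  exact: vmeasurable_slice.
pose F (x : Rm * Rm) := iint (fun z => f (vcons x.1 (vinsert j x.2 z))).
rewrite (fubini_tonelli (m1 := mu) (m2 := mu) F); last 2 first.
- apply: measurable_iint => //.
  pose h (x : (Rm * Rm) * n.-tuple Rm) : Rm * n.+1.-tuple Rm :=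
    (x.1.1, [tuple vinsert j x.1.2 (tnth x.2) k | k < n.+1]).
  rewrite [X in measurable_fun _ X](_ : _ =
    (fun x : Rm * n.+1.-tuple Rm => f (vcons x.1 (tnth x.2))) \o h); last first.
    apply/funext => x /=; congr f; congr vcons; apply/funext => k.
    by rewrite tnth_mktuple.
  apply: measurableT_comp; first exact: vmeasurable_vcons.
  apply/measurable_fun_pairP; split => /=.
    exact: (measurableT_comp measurable_fst measurable_fst).
  apply/measurable_fun_tnthP => k.
  rewrite (_ : _ \o _ = (fun x => vinsert j x.1.2 (tnth x.2) k)); last first.
    by apply/funext => x /=; rewrite tnth_mktuple.
  rewrite /vinsert; case: (unlift j k) => [l|].
    exact: (measurableT_comp (measurable_tnth l) measurable_snd).
  exact: (measurableT_comp measurable_snd measurable_fst).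
- by move=> x; apply: iint_ge0.
apply: eq_integral => t _ /=; apply: eq_integral => s _.
by congr iint; apply/funext => z; rewrite vinsert_lift.
Qed.

End IteratedIntegral.

(** * Reflections and dilations under the iterated integral *)

Section ChangeOfVariables.
Variable R : realType.
Local Notation mu := (@lebesgue_measure R).
Local Notation Rm := (measurableTypeR R).

Lemma integral_oppr (f : Rm -> \bar R) : measurable_fun setT f ->
  (forall t, 0 <= f t)%E ->
  (\int[mu]_t f (- t)%R = \int[mu]_t f t)%E.
Proof.
move=> mf f0.
have := @ge0_integral_pushforward _ _ Rm Rm R (-%R : Rm -> Rm) (@oppr_measurable R setT) mu setT f measurableT mf (fun y _ => f0 y).
rewrite preimage_setT => <-.
by apply: eq_measure_integral => //= A mA _; rewrite lebesgue_measureN.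
Qed.

(** Lebesgue measure equals [c] times its pushforward under [t -> c t]: both agree on half-open
    intervals, and Lebesgue measure is determined by these. *)
Lemma integral_scaler (c : R) (f : Rm -> \bar R) : 0 < c ->
  measurable_fun setT f -> (forall t, 0 <= f t)%E ->
  (\int[mu]_t f t = c%:E * \int[mu]_t f (c * t)%R)%E.
Proof.
move=> c0 mf f0.
pose phi : Rm -> Rm := fun t => c * t.
have mphi : measurable_fun setT phi by exact: mulrl_measurable.
pose P : {measure set Rm -> \bar R} :=
  measure_function_pushforward__canonical__measure_function_Measure mu mphi.
pose nu := mscale (NngNum (ltW c0)) P.
have nuE A : measurable A -> mu A = nu A.
  apply: lebesgue_measure_unique => _ [[a b]] _ <-.
  change (mu `]a, b]%classic = c%:E * mu (phi @^-1` `]a, b]%classic))%E.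
  have -> : phi @^-1` `]a, b]%classic = `](c^-1 * a), (c^-1 * b)]%classic.
    apply/seteqP; split => t /=; rewrite !in_itv /= /phi;
    by rewrite ltr_pdivrMl ?ler_pdivlMl.
  rewrite !lebesgue_measure_itv /= !lte_fin ltr_pM2l ?invr_gt0//.
  case: ifP => _; last by rewrite mule0.
  by rewrite -!EFinB -EFinM; congr EFin; rewrite -mulrBr mulrA divff ?gt_eqF// mul1r.
rewrite (eq_measure_integral nu); last by move=> A mA _; exact: nuE.
rewrite ge0_integral_mscale//; congr (_ * _)%E.
by rewrite ge0_integral_pushforward// preimage_setT.
Qed.

Lemma vmeasurable_map n (f : ('I_n -> R) -> \bar R) (h : 'I_n -> R -> R) :
  (forall i, measurable_fun setT (h i : Rm -> Rm)) ->
  vmeasurable f -> vmeasurable (fun z => f (fun i => h i (z i))).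
Proof.
move=> mh mf.
pose H (x : n.-tuple Rm) : n.-tuple Rm := [tuple h k (tnth x k) | k < n].
rewrite /vmeasurable [X in measurable_fun _ X](_ : _ = (fun z : n.-tuple Rm => f (tnth z)) \o H); last first.
  by apply/funext => x /=; congr f; apply/funext => k; rewrite tnth_mktuple.
apply: measurableT_comp => //.
apply/measurable_fun_tnthP => k.
rewrite (_ : _ \o _ = (fun x => h k (tnth x k))); last first.
  by apply/funext => x /=; rewrite tnth_mktuple.
exact: (measurableT_comp (mh k) (measurable_tnth k)).
Qed.

Lemma iint_scaler n (c : R) (f : ('I_n -> R) -> \bar R) : 0 < c ->
  (forall z, 0 <= f z)%E -> vmeasurable f ->
  iint f = ((c ^+ n)%:E * iint (fun z => f (fun i => c * z i)%R))%E.
Proof.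
move=> c0; elim: n f => [|n IH] f f0 mf.
  by rewrite /= expr0 mul1e; congr f; apply/funext => -[].
have mg : vmeasurable (fun z : 'I_n.+1 -> R => f (fun i => c * z i)).
  by apply: (vmeasurable_map (h := fun _ t => c * t)) => // _; exact: mulrl_measurable.
rewrite /= (@integral_scaler c) //; last 2 first.
- exact: measurable_iint_slice.
- by move=> t; apply: iint_ge0.
rewrite exprS EFinM -muleA; congr (_ * _)%E.
rewrite -ge0_integralZl//; last 3 first.
- exact: (measurable_iint_slice _ mg).
- by move=> t _; apply: iint_ge0.
- by rewrite lee_fin exprn_ge0// ltW.
apply: eq_integral => t _; rewrite IH//; last exact: vmeasurable_slice.
congr (_ * _)%E; congr iint; apply/funext => z; congr f; apply/funext => k.
by rewrite /vcons; case: unlift.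
Qed.

Definition vflip n (i : 'I_n) (z : 'I_n -> R) : 'I_n -> R :=
  fun k => if k == i then - z k else z k.

Lemma vflip_vinsert n (i : 'I_n.+1) (t : R) (z : 'I_n -> R) :
  vflip i (vinsert i t z) = vinsert i (- t) z.
Proof.
apply/funext => k; rewrite /vflip /vinsert.
case: unliftP => [j ->|->]; last by rewrite eqxx.
by rewrite eq_sym (negbTE (neq_lift _ _)).
Qed.

Lemma vmeasurable_vflip n (i : 'I_n) (f : ('I_n -> R) -> \bar R) :
  vmeasurable f -> vmeasurable (fun z => f (vflip i z)).
Proof.
apply: (vmeasurable_map (h := fun k t => if k == i then - t else t)) => k.
by case: eqP => _; [exact: oppr_measurable|exact: measurable_id].
Qed.

(** Once coordinate [i] is made outermost, this is the invariance of the one-dimensional integral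
    under [t -> -t]. *)
Lemma iint_vflip n (i : 'I_n) (f : ('I_n -> R) -> \bar R) :
  (forall z, 0 <= f z)%E -> vmeasurable f ->
  iint (fun z => f (vflip i z)) = iint f.
Proof.
case: n i f => [[]//|n] i f f0 mf.
rewrite (iint_vinsert i)//; last exact: vmeasurable_vflip.
rewrite [RHS](iint_vinsert i)//.
rewrite -[RHS]integral_oppr//; last 2 first.
- by apply: measurable_iint => //; exact: vmeasurable_vinsert.
- by move=> t; apply: iint_ge0.
apply: eq_integral => t _; congr iint; apply/funext => z.
by rewrite vflip_vinsert.
Qed.

End ChangeOfVariables.

(** * One-dimensional slices and moments of the unit ball *)

Section BallSlices.
Variable R : realType.
Local Notation mu := (@lebesgue_measure R).
Local Notation Rm := (measurableTypeR R).

Definition rmeasurable (n : nat) (F : ('I_n -> R) -> R) :=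
  measurable_fun setT (fun z : n.-tuple Rm => F (tnth z) : Rm).

Lemma rmeasurable_vmeasurable n (F : ('I_n -> R) -> R) :
  rmeasurable F -> vmeasurable (fun z => (F z)%:E).
Proof. by move=> mF; exact/measurable_EFinP. Qed.

Lemma rmeasurableD n (F G : ('I_n -> R) -> R) : rmeasurable F -> rmeasurable G ->
  rmeasurable (fun z => F z + G z).
Proof. by move=> mF mG; exact: measurable_funD. Qed.

Lemma rmeasurableM n (F G : ('I_n -> R) -> R) : rmeasurable F -> rmeasurable G ->
  rmeasurable (fun z => F z * G z).
Proof. by move=> mF mG; exact: measurable_funM. Qed.

Lemma rmeasurableX n (F : ('I_n -> R) -> R) k : rmeasurable F ->
  rmeasurable (fun z => F z ^+ k).
Proof. by move=> mF; exact: measurable_funX. Qed.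

Lemma rmeasurable_coord n (i : 'I_n) (phi : R -> R) :
  measurable_fun setT (phi : Rm -> Rm) -> rmeasurable (fun z => phi (z i)).
Proof. by move=> mphi; exact: (measurableT_comp mphi (measurable_tnth i)). Qed.

Lemma rmeasurable_cst n (c : R) : rmeasurable (fun _ : 'I_n -> R => c).
Proof. exact: measurable_cst. Qed.

Lemma rmeasurable_sum n m (F : 'I_m -> ('I_n -> R) -> R) (P : pred 'I_m) :
  (forall i, rmeasurable (F i)) -> rmeasurable (fun z => \sum_(i | P i) F i z).
Proof.
move=> mF; rewrite /rmeasurable.
rewrite (_ : (fun _ => _) = \sum_(i | P i) (fun z : n.-tuple Rm => F i (tnth z))).
  by elim/big_ind: _ => [|f g mf mg|i _]; [exact: measurable_cst|exact: measurable_funD|exact: mF].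
by apply/funext => z; rewrite fct_sumE.
Qed.

Lemma rmeasurable_bool n (P : ('I_n -> R) -> bool) :
  measurable_fun setT (fun z : n.-tuple Rm => P (tnth z)) ->
  rmeasurable (fun z => (P z)%:R).
Proof.
move=> mP.
have mb : measurable_fun [set: bool] (fun b : bool => b%:R : Rm) by [].
exact: (measurableT_comp mb mP).
Qed.

Lemma rmeasurable_le n (F G : ('I_n -> R) -> R) : rmeasurable F -> rmeasurable G ->
  rmeasurable (fun z => (F z <= G z)%R%:R).
Proof. by move=> mF mG; apply: rmeasurable_bool; exact: measurable_fun_ler. Qed.

Lemma rmeasurable_lt n (F G : ('I_n -> R) -> R) : rmeasurable F -> rmeasurable G ->
  rmeasurable (fun z => (F z < G z)%R%:R).
Proof. by move=> mF mG; apply: rmeasurable_bool; exact: measurable_fun_ltr. Qed.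

Lemma rmeasurable_prod n m (F : 'I_m -> ('I_n -> R) -> R) :
  (forall i, rmeasurable (F i)) -> rmeasurable (fun z => \prod_i F i z).
Proof.
move=> mF; rewrite /rmeasurable.
elim: (index_enum _) => [|i s IH].
  by under eq_fun do rewrite big_nil; exact: measurable_cst.
by under eq_fun do rewrite big_cons; apply: measurable_funM => //; exact: mF.
Qed.

(** The factor [phi (z i)] is constant on each slice orthogonal to axis [i], so a moment of one
    coordinate becomes a one-dimensional integral against the slice masses. *)
Lemma iint_coord n (i : 'I_n.+1) (b : ('I_n.+1 -> R) -> R) (phi : R -> R) :
  (forall z, 0 <= b z) -> rmeasurable b -> (forall t, 0 <= phi t) ->
  measurable_fun setT (phi : Rm -> Rm) ->
  iint (fun z => (b z * phi (z i))%:E) =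
  (\int[mu]_t ((phi t)%:E * iint (fun z => (b (vinsert i t z))%:E)))%E.
Proof.
move=> b0 mb phi0 mphi; rewrite (iint_vinsert i).
- apply: eq_integral => t _; rewrite -iintZ//.
    congr iint; apply/funext => z.
    by rewrite /vinsert unlift_none EFinM muleC.
    by move=> z; rewrite lee_fin.
  pose g x := (b (@vinsert R n i x.1 (@tnth n Rm x.2)))%:E.
  have mg : measurable_fun setT g.
    by apply: (@vmeasurable_vinsert _ _ i (fun z => (b z)%:E)); exact: rmeasurable_vmeasurable.
  exact: (measurableT_comp mg (pair1_measurable t)).
- by move=> z; rewrite lee_fin mulr_ge0.
- by apply: rmeasurable_vmeasurable; apply: rmeasurableM => //; exact: rmeasurable_coord.
Qed.

Lemma integral_itv_cst (x y c : R) : x <= y -> 0 <= c ->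
  (\int[mu]_t (c * (x <= t <= y)%R%:R)%:E = (c * (y - x))%:E)%E.
Proof.
move=> xy c0.
rewrite (eq_integral (fun t : Rm => c%:E * (\1_`[x, y]%classic t)%:E)%E); last first.
  by move=> t _; rewrite indicE mem_setE in_itv EFinM.
rewrite ge0_integralZl//; try by [move=> t _; rewrite lee_fin|apply/measurable_EFinP; exact: measurable_indic].
rewrite integral_indic// setIT [X in (_ * X)%E](lebesgue_measure_itv `[x,y]) /= lte_fin EFinM.
congr (_ * _)%E; case: ltP => //= yx.
by rewrite (_ : x = y) ?subrr//; apply/eqP; rewrite eq_le xy.
Qed.

(** The integrand is dominated by [1/r] times the exponential density plus its reflection, each of
    total mass 1. The two overlap at [t = 0], where the domination is strict. *)
Lemma integral_exp_norm_le (r : R) : 0 < r ->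
  (\int[mu]_t (expR (- r * `|t|))%:E <= (2 / r)%:E)%E.
Proof.
move=> r0; pose f := exponential_pdf r.
have f0 t : 0 <= f t by apply: exponential_pdf_ge0; exact: ltW.
have mf : measurable_fun setT (EFin \o f : Rm -> \bar R).
  by apply/measurable_EFinP; apply: measurable_exponential_pdf; exact: ltW.
have mfN : measurable_fun setT (fun t : Rm => (f (- t))%:E).
  exact: (measurableT_comp mf (@oppr_measurable R setT)).
have I1 : (\int[mu]_t (f t)%:E = 1)%E by exact: integral_exponential_pdf.
apply: (@le_trans _ _ (\int[mu]_t (r^-1%:E * ((f t)%:E + (f (- t))%:E)))%E).
  apply: le_integral_ge0 => t; first by rewrite lee_fin expR_ge0.
  rewrite -EFinD -EFinM lee_fin.
  have pdfE s : 0 <= s -> f s = r * expR (- r * s) by exact: exponential_pdfE.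
  have [t0|t0] := leP 0 t.
    rewrite ger0_norm// mulrDr (pdfE t)// mulKf ?gt_eqF//.
    by rewrite lerDl mulr_ge0// invr_ge0 ltW.
  rewrite ltr0_norm// mulrDr (pdfE (- t)) ?oppr_ge0; last exact: ltW.
  rewrite mulKf ?gt_eqF//.
  by rewrite lerDr mulr_ge0// invr_ge0 ltW.
rewrite ge0_integralZl//; try by
  [rewrite lee_fin invr_ge0 ltW|move=> t _; rewrite adde_ge0// lee_fin|exact: emeasurable_funD].
rewrite ge0_integralD//; try by move=> t _; rewrite lee_fin.
rewrite (@integral_oppr _ (EFin \o f))//; try by move=> t; rewrite lee_fin.
by rewrite I1 -EFinD -EFinM lee_fin mulrC.
Qed.

Lemma iint_box n (r : R) : 0 <= r ->
  iint (fun z : 'I_n -> R => (\prod_i (`|z i| <= r)%R%:R)%:E) = ((2 * r) ^+ n)%:E.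
Proof.
move=> r0; elim: n => [|n IH]; first by rewrite /= big_ord0.
rewrite /=.
rewrite (eq_integral (fun t : Rm => ((2 * r) ^+ n * (- r <= t <= r)%R%:R)%:E)).
  by rewrite integral_itv_cst ?exprn_ge0 ?mulr_ge0//; [congr EFin; rewrite exprS; ring|lra].
move=> t _; rewrite -ler_norml EFinM -IH muleC -iintZ//.
- congr iint; apply/funext => z; rewrite big_ord_recl EFinM.
  congr (_%:E * _%:E)%E; first by rewrite /vcons unlift_none.
  by apply: eq_bigr => i _; rewrite /vcons liftK.
- by move=> z; rewrite lee_fin prodr_ge0.
- apply: rmeasurable_vmeasurable; apply: rmeasurable_prod => i.
  apply: rmeasurable_le; last exact: rmeasurable_cst.
  by apply: (rmeasurable_coord i (phi := Num.norm)); exact: normr_measurable.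
Qed.

End BallSlices.

(** * Mass and moments of one coordinate from bounds on the slices *)

Section SliceMoments.
Variable R : realType.
Local Notation mu := (@lebesgue_measure R).
Local Notation Rm := (measurableTypeR R).

Lemma measurable_exp_norm (c : R) :
  measurable_fun setT (fun t : Rm => (expR (c * `|t|))%:E).
Proof.
apply/measurable_EFinP.
exact: (measurableT_comp (@measurable_expR R)
  (measurableT_comp (@mulrl_measurable R setT c) (@normr_measurable R setT))).
Qed.

(** In the applications [b] is the indicator of the unit ball in dimension [n.+1], [V] the volume of
    the unit ball in dimension [n], and [a] is [d^(-1/p)] with [d = n.+1], the scale of a typical
    coordinate. Mass and single-coordinate moments are estimated from these two bounds alone, which
    is what makes the constants independent of [d] and [p]. *)
Definition slice_bounds n (b : ('I_n.+1 -> R) -> R) (a V : R) :=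
  forall i t,
    (`|t| <= a -> ((expR (- 1) * V)%:E <= iint (fun z => (b (vinsert i t z))%:E))%E) /\
    (iint (fun z => (b (vinsert i t z))%:E) <=
       (expR 2^-1 * V * expR (- (2 * a)^-1 * `|t|))%:E)%E.

Variables (n : nat) (b : ('I_n.+1 -> R) -> R) (a V : R).
Hypotheses (b0 : forall z, 0 <= b z) (mb : rmeasurable b).
Hypotheses (a0 : 0 < a) (V0 : 0 < V) (sb : slice_bounds b a V).

Lemma mass_le : (iint (fun z => (b z)%:E) <= (4 * expR 2^-1 * (a * V))%:E)%E.
Proof.
rewrite (iint_vinsert ord0)//; try by [move=> z; rewrite lee_fin|exact: rmeasurable_vmeasurable].
apply: (@le_trans _ _ (\int[mu]_t ((expR 2^-1 * V)%:E * (expR (- (2 * a)^-1 * `|t|))%:E))%E).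
  apply: le_integral_ge0 => t; first by apply: iint_ge0 => z; rewrite lee_fin.
  by rewrite -EFinM; exact: (sb ord0 t).2.
have mexp := measurable_exp_norm (- (2 * a)^-1).
have a20 : 0 < (2 * a)^-1 by rewrite invr_gt0 mulr_gt0.
rewrite ge0_integralZl//; try by
  [rewrite lee_fin mulr_ge0// ?expR_ge0// ltW|move=> t _; rewrite lee_fin expR_ge0].
apply: (le_trans (lee_pmul _ _ (lexx _) (integral_exp_norm_le a20))).
- by rewrite lee_fin mulr_ge0// ?expR_ge0// ltW.
- by apply: integral_ge0 => t _; rewrite lee_fin expR_ge0.
by rewrite -EFinM lee_fin invrK le_eqVlt; apply/orP; left; apply/eqP; ring.
Qed.

Lemma mass_ge : ((2 * expR (- 1) * (a * V))%:E <= iint (fun z => (b z)%:E))%E.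
Proof.
rewrite (iint_vinsert ord0)//; try by [move=> z; rewrite lee_fin|exact: rmeasurable_vmeasurable].
have c0 : 0 <= expR (- 1) * V by rewrite mulr_ge0// ?expR_ge0// ltW.
rewrite (_ : 2 * expR (- 1) * (a * V) = expR (- 1) * V * (a - - a)); last by ring.
rewrite -integral_itv_cst//; last by move: a0; lra.
apply: le_integral_ge0 => t; first by rewrite lee_fin mulr_ge0.
rewrite -ler_norml; case: (leP `|t| a) => ta; first by rewrite mulr1; exact: (sb ord0 t).1.
by rewrite mulr0; apply: iint_ge0 => z; rewrite lee_fin.
Qed.

(** Only the slices with [a/2 <= t <= a] are counted: there [t^2 >= (a/2)^2], each slice has mass at
    least [e^-1 V], and the interval has length [a/2]. *)
Lemma moment2_ge (i : 'I_n.+1) :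
  ((expR (- 1) / 8 * (a ^+ 3 * V))%:E <= iint (fun z => (b z * z i ^+ 2)%:E))%E.
Proof.
rewrite (@iint_coord _ _ i b (fun t => t ^+ 2))//; try by
  [move=> t; exact: sqr_ge0|exact: exprn_measurable].
have c0 : 0 <= (a / 2) ^+ 2 * (expR (- 1) * V) by rewrite !mulr_ge0// ?expR_ge0 ?sqr_ge0// ltW.
rewrite (_ : expR (- 1) / 8 * (a ^+ 3 * V) = (a / 2) ^+ 2 * (expR (- 1) * V) * (a - a / 2)); last by field.
rewrite -integral_itv_cst//; last by move: a0; lra.
apply: le_integral_ge0 => t; first by rewrite lee_fin mulr_ge0.
have [/andP[ta1 ta2]|_] := boolP (_ <= t <= _); last first.
  by rewrite mulr0 mule_ge0// ?lee_fin ?sqr_ge0//; apply: iint_ge0 => z; rewrite lee_fin.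
rewrite mulr1 EFinM; apply: lee_pmul => //.
- by rewrite lee_fin sqr_ge0.
- by rewrite lee_fin mulr_ge0// ?expR_ge0 ?ltW.
- by rewrite lee_fin lerXn2r// ?nnegrE; move: a0; lra.
by apply: (sb i t).1; rewrite ger0_norm; move: a0; lra.
Qed.

(** The decay [e^(-|t|/(2a))] is split into two equal factors. One absorbs [t^4]: with
    [x = |t|/(16a)], the inequality [x <= e^x] gives [t^4 e^(-|t|/(4a)) <= (16a)^4]. The other is
    integrated and contributes [8a]. *)
Lemma moment4_le (i : 'I_n.+1) :
  (iint (fun z => (b z * z i ^+ 4)%:E) <= (8 * 16 ^+ 4 * expR 2^-1 * (a ^+ 5 * V))%:E)%E.
Proof.
rewrite (@iint_coord _ _ i b (fun t => t ^+ 4))//; try by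
  [move=> t; rewrite exprn_even_ge0|exact: exprn_measurable].
apply: (@le_trans _ _ (\int[mu]_t (((16 * a) ^+ 4 * (expR 2^-1 * V))%:E * (expR (- (4 * a)^-1 * `|t|))%:E))%E).
  apply: le_integral_ge0 => t.
    rewrite mule_ge0// ?lee_fin ?exprn_even_ge0//.
    by apply: iint_ge0 => z; rewrite lee_fin.
  apply: (le_trans (lee_pmul _ _ (lexx _) (sb i t).2)).
  - by rewrite lee_fin exprn_even_ge0.
  - by apply: iint_ge0 => z; rewrite lee_fin.
  rewrite -!EFinM lee_fin.
  rewrite (_ : - (2 * a)^-1 * `|t| = - (4 * a)^-1 * `|t| + - (4 * a)^-1 * `|t|); last by field; rewrite gt_eqF.
  rewrite expRD; set E := expR (_ * `|t|); set K := expR _.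
  suff tE : t ^+ 4 * E <= (16 * a) ^+ 4.
    rewrite (_ : t ^+ 4 * _ = (t ^+ 4 * E) * (K * V * E)); last by ring.
    rewrite -[leRHS]mulrA ler_wpM2r// !mulr_ge0 ?expR_ge0//; exact: ltW.
  pose x := `|t| / (16 * a).
  have x0 : 0 <= x by rewrite divr_ge0// mulr_ge0// ltW.
  have -> : t ^+ 4 = (16 * a) ^+ 4 * x ^+ 4.
    rewrite -exprMn /x mulrC divfK ?gt_eqF ?mulr_gt0//.
    by rewrite -normrX ger0_norm// exprn_even_ge0.
  rewrite -mulrA -[leRHS]mulr1 ler_wpM2l ?exprn_ge0 ?mulr_ge0 ?(ltW a0)//.
  rewrite /E (_ : - (4 * a)^-1 * `|t| = - (4%:R * x)); last by rewrite /x; field; rewrite gt_eqF.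
  rewrite expRN expRM_natl ler_pdivrMr ?exprn_gt0 ?expR_gt0// mul1r.
  rewrite lerXn2r ?nnegrE ?expR_ge0//.
  by apply: le_trans (expR_ge1Dx x); lra.
have mexp := measurable_exp_norm (- (4 * a)^-1).
have a40 : 0 < (4 * a)^-1 by rewrite invr_gt0 mulr_gt0.
have k0 : 0 <= (16 * a) ^+ 4 * (expR 2^-1 * V).
  by rewrite !mulr_ge0// ?expR_ge0// ?exprn_ge0 ?mulr_ge0// ltW.
rewrite ge0_integralZl//; try by move=> t _; rewrite lee_fin expR_ge0.
apply: (le_trans (lee_pmul _ _ (lexx _) (integral_exp_norm_le a40))).
- by rewrite lee_fin.
- by apply: integral_ge0 => t _; rewrite lee_fin expR_ge0.
by rewrite -EFinM lee_fin invrK le_eqVlt; apply/orP; left; apply/eqP; ring.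
Qed.

End SliceMoments.

(** * The unit ball through power sums, and its volume *)

Section LpBall.
Variable R : realType.
Local Notation mu := (@lebesgue_measure R).
Local Notation Rm := (measurableTypeR R).

(** Without the root the coordinates contribute additively, so that slicing the ball at [t] merely
    lowers the threshold from [1] to [1 - |t|^q]. *)
Definition psum n (q : R) (z : 'I_n -> R) : R := \sum_i `|z i| `^ q.

Definition ball_ind n (p : \bar R) (z : 'I_n -> R) : R :=
  \1_(@lpball R n p) (\row_i z i).

Lemma powR1_1 (r : R) : 1 `^ r = 1. Proof. by rewrite powR1. Qed.

Lemma ball_ind_fin n (q : R) (z : 'I_n -> R) : 1 <= q ->
  ball_ind q%:E z = (psum q z <= 1)%R%:R.
Proof.
move=> q1; have q0 : 0 < q by lra.
rewrite /ball_ind indicE /lpball; have s0 : 0 <= psum q z by rewrite sumr_ge0// => i _; exact: powR_ge0.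
have E : (\sum_i `|(\row_j z j) ord0 i| `^ q) `^ q^-1 = psum q z `^ q^-1.
  by congr (_ `^ _); apply: eq_bigr => i _; rewrite mxE.
congr (_%:R); congr nat_of_bool; apply/idP/idP; rewrite inE /= E.
  move=> h; rewrite leNgt; apply/negP => h1; move: h; apply/negP; rewrite -ltNge.
  by rewrite -[ltLHS](powR1_1 q^-1) gt0_ltr_powR ?invr_gt0 ?nnegrE.
by move=> h; rewrite -[leRHS](powR1_1 q^-1) ge0_ler_powR ?invr_ge0 ?nnegrE ?(ltW q0).
Qed.

Lemma ball_ind_inf n (z : 'I_n -> R) :
  ball_ind +oo%E z = \prod_i (`|z i| <= 1)%R%:R.
Proof.
rewrite /ball_ind indicE /lpball.
have [h|h] := boolP [forall i, `|z i| <= 1].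
  rewrite mem_set /=; last first.
    by apply/bigmax_leP; split => // i _; rewrite mxE; exact: (forallP h).
  by rewrite big1// => i _; rewrite (forallP h).
move: (h); rewrite negb_forall => /existsP[i hi].
rewrite memNset /=; last first.
  move=> /bigmax_leP[_ /(_ i isT)]; rewrite mxE => hi'; by rewrite hi' in hi.
by rewrite (bigD1 i)//= (negbTE hi) mul0r.
Qed.

Lemma rmeasurable_abs_powR n (i : 'I_n) (q : R) :
  rmeasurable (fun z => `|z i| `^ q).
Proof.
apply: (rmeasurable_coord i (phi := fun t => `|t| `^ q)).
exact: (measurableT_comp (measurable_powR q) (@normr_measurable R setT)).
Qed.

Lemma rmeasurable_psum n (q : R) : rmeasurable (@psum n q).
Proof.
by apply: (rmeasurable_sum (F := fun i z => `|z i| `^ q)) => i; exact: rmeasurable_abs_powR.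
Qed.

Lemma rmeasurable_ball_ind n (p : \bar R) : (1 <= p)%E -> rmeasurable (@ball_ind n p).
Proof.
case: p => [q| |]// q1.
  rewrite (_ : ball_ind _ = fun z => (psum q z <= 1)%R%:R); last first.
    by apply/funext => z; exact: ball_ind_fin.
  by apply: rmeasurable_le; [exact: rmeasurable_psum|exact: rmeasurable_cst].
rewrite (_ : ball_ind _ = fun z => \prod_i (`|z i| <= 1)%R%:R); last first.
  by apply/funext => z; exact: ball_ind_inf.
apply: rmeasurable_prod => i; apply: rmeasurable_le; last exact: rmeasurable_cst.
by apply: (rmeasurable_coord i (phi := Num.norm)); exact: normr_measurable.
Qed.

Lemma psum_vinsert n (q : R) (i : 'I_n.+1) t (z : 'I_n -> R) :
  psum q (vinsert i t z) = `|t| `^ q + psum q z.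
Proof.
rewrite /psum (bigD1_ord i)//= /vinsert unlift_none; congr (_ + _).
by apply: eq_bigr => j _; rewrite liftK.
Qed.

(** For [q >= 1] and [s >= 0] this is the volume of the l_q ball of radius [s^(1/q)]; for [s < 0]
    the set is empty, which covers slices that miss the ball. *)
Definition psum_vol n (q s : R) : \bar R :=
  iint (fun z : 'I_n -> R => ((psum q z <= s)%R%:R)%:E).

Lemma psum_vol_le n (q s s' : R) : s <= s' -> (psum_vol n q s <= psum_vol n q s')%E.
Proof.
move=> ss'; apply: le_iint => z; rewrite lee_fin//.
by case: (leP _ s) => [h|_]; [rewrite (le_trans h)|exact: ler0n].
Qed.

Lemma psum_vol_scale n (q s : R) : 1 <= q -> 0 < s ->
  psum_vol n q s = ((s `^ (n%:R / q))%:E * psum_vol n q 1)%E.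
Proof.
move=> q1 s0; have q0 : 0 < q by lra.
have c0 : 0 < s `^ q^-1 by exact: powR_gt0.
rewrite /psum_vol (@iint_scaler _ n (s `^ q^-1))//; last first.
  by apply: rmeasurable_vmeasurable; apply: rmeasurable_le; [exact: rmeasurable_psum|exact: rmeasurable_cst].
rewrite -powR_mulrn ?powR_ge0// -powRrM mulrC; congr (_ * _)%E.
congr iint; apply/funext => z; congr (_%:R%:E); congr nat_of_bool.
rewrite -[in RHS](ler_pM2l s0) mulr1; congr (_ <= _).
rewrite /psum mulr_sumr; apply: eq_bigr => i _.
by rewrite normrM powRM// ger0_norm ?powR_ge0// -powRrM mulVf ?gt_eqF// powRr1// ltW.
Qed.

Lemma psum_le1_coord n (q : R) (z : 'I_n -> R) i : 1 <= q -> psum q z <= 1 -> `|z i| <= 1.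
Proof.
move=> q1 h; have q0 : 0 < q by lra.
case: (leP `|z i| 1) => // zi.
suff : 1 < psum q z by rewrite ltNge h.
rewrite /psum (bigD1 i)//=; apply: (@lt_le_trans _ _ (`|z i| `^ q)).
  by rewrite -[ltLHS](powR1_1 q) gt0_ltr_powR ?nnegrE.
by rewrite lerDl sumr_ge0// => j _; exact: powR_ge0.
Qed.

(** The ball lies in the cube of half-side [1], hence has finite volume, and contains the cube of
    half-side [1/(n+1)], hence has positive volume. *)
Lemma psum_vol1_bounds n (q : R) : 1 <= q ->
  exists2 V : R, 0 < V & psum_vol n q 1 = V%:E.
Proof.
move=> q1; have q0 : 0 < q by lra.
have up : (psum_vol n q 1 <= ((2 * 1) ^+ n)%:E)%E.
  rewrite -iint_box//; apply: le_iint => z; first by rewrite lee_fin.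
  rewrite lee_fin; case: (leP (psum q z) 1) => [h|_]; last by rewrite prodr_ge0.
  by rewrite big1// => i _; rewrite (psum_le1_coord i q1 h).
have lo : (((2 * n.+1%:R^-1) ^+ n)%:E <= psum_vol n q 1)%E.
  rewrite -iint_box//; apply: le_iint => z; first by rewrite lee_fin prodr_ge0.
  rewrite lee_fin.
  have [h|h] := boolP [forall i, `|z i| <= n.+1%:R^-1]; last first.
    move: (h); rewrite negb_forall => /existsP[i hi].
    by rewrite (bigD1 i)//= (negbTE hi) mul0r.
  (* Since [|z i| <= 1] and [q >= 1], each term is at most [|z i| <= 1/(n+1)]. The denominator
     [n.+1] instead of [n] includes the case [n = 0]. *)
  have -> : (psum q z <= 1).
    apply: (@le_trans _ _ (\sum_(i < n) n.+1%:R^-1)).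
      apply: ler_sum => i _; apply: le_trans (forallP h i).
      have [->|zi] := eqVneq (z i) 0; first by rewrite normr0 powR0// gt_eqF.
      rewrite ge1r_powR// normr_gt0 zi (le_trans (forallP h i))//.
      by rewrite invf_le1 ?ler1n.
    rewrite sumr_const card_ord -[_ *+ _]mulr_natr mulrC ler_pdivrMr// mul1r ler_nat//.
  by rewrite big1// => i _; rewrite (forallP h).
have fin : psum_vol n q 1 \is a fin_num.
  rewrite fin_numE; apply/andP; split; first by rewrite gt_eqF// (lt_le_trans _ lo)// ltNyr.
  by rewrite lt_eqF// (le_lt_trans up)// ltry.
exists (fine (psum_vol n q 1)); last by rewrite fineK.
rewrite -lte_fin fineK//; apply: lt_le_trans lo.
by rewrite lte_fin exprn_gt0// mulr_gt0// invr_gt0.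
Qed.

End LpBall.

(** * Moments and tails of linear forms *)

Section LpBallSlices.
Variable R : realType.

(** Young's inequality for the product [y * 1] gives [y <= y^q/q + (1 - 1/q)]. The case [q = 1] is
    separate because its conjugate exponent is infinite. It serves to replace decay in [y^q/q] by
    exponential decay in [y], uniformly in [q]. *)
Lemma le_powR_div (y q : R) : 1 <= q -> 0 <= y -> y - 1 <= y `^ q / q.
Proof.
move=> q1 y0; have q0 : 0 < q by lra.
have [->|qn1] := eqVneq q 1; first by rewrite powRr1// divr1; lra.
have q'0 : 0 < q - 1 by rewrite subr_gt0 lt_neqAle eq_sym qn1.
have e : q^-1 + (q / (q - 1))^-1 = 1 by field; rewrite !gt_eqF.
have := @conjugate_powR R y 1 q (q / (q - 1)) y0 ler01 q0 (divr_gt0 q0 q'0) e.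
rewrite mulr1 powR1_1 mul1r (_ : (q / (q - 1))^-1 = 1 - q^-1); last by move: e; lra.
have : 0 < q^-1 by rewrite invr_gt0.
lra.
Qed.

Lemma slice_ball_fin n (q : R) (i : 'I_n.+1) (t : R) : 1 <= q ->
  iint (fun z => (ball_ind q%:E (vinsert i t z))%:E) = psum_vol n q (1 - `|t| `^ q).
Proof.
move=> q1; congr iint; apply/funext => z; rewrite ball_ind_fin// psum_vinsert.
by rewrite lerBrDl.
Qed.

Lemma expR_le_slice (t : R) : `|t| <= 1 -> 1 <= expR 2^-1 * expR (- (2 * 1)^-1 * `|t|).
Proof. by move=> t1; rewrite -expRD -[leLHS]expR0 ler_expR; lra. Qed.

Lemma expRN1_le1 : expR (- 1) <= 1 :> R.
Proof. by rewrite -[leRHS]expR0 ler_expR; lra. Qed.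

(** By scaling, a slice with threshold [s > 0] has volume [s^(n/q) V]. Both bounds follow by
    comparing [1 - |t|^q] with an exponential before taking this power, using [a^q = 1/(n+1)]. *)
Lemma slice_bounds_fin n (q V : R) : 1 <= q -> 0 < V -> psum_vol n q 1 = V%:E ->
  slice_bounds (@ball_ind R n.+1 q%:E) (n.+1%:R `^ q^-1)^-1 V.
Proof.
move=> q1 V0 VE i t; have q0 : 0 < q by lra.
rewrite !slice_ball_fin//.
set a := (_ `^ _)^-1; have a0 : 0 < a by rewrite invr_gt0 powR_gt0.
have aq : a `^ q = n.+1%:R^-1.
  by rewrite /a -powRN -powRrM mulNr mulVf ?gt_eqF// powR_inv1.
(* In dimension one the slices are points, whose mass drops from [V] to [0] beyond [|t| = 1]. This
   case is apart because the ratio [n/(n+1)], bounded below by [1/2] in the general case, is [0]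
   here. *)
case: n => [|n] in V V0 VE i a a0 aq *.
  have vol0 s : 0 <= s -> psum_vol 0 q s = V%:E.
    by move=> s0; rewrite -VE /psum_vol /= /psum !big_ord0 s0 ler01.
  have a1 : a = 1 by rewrite /a powR1_1 invr1.
  have tq : (`|t| `^ q <= 1) = (`|t| <= 1).
    apply/idP/idP => h; last first.
      by rewrite -[leRHS](powR1_1 q) ge0_ler_powR ?nnegrE ?(ltW q0).
    rewrite leNgt; apply/negP => h1; move: h; apply/negP; rewrite -ltNge.
    by rewrite -[ltLHS](powR1_1 q) gt0_ltr_powR ?nnegrE.
  rewrite a1; split => [t1|].
    by rewrite vol0 ?subr_ge0 ?tq// lee_fin ger_pMl// expRN1_le1.
  have [t1|t1] := leP `|t| 1.
    rewrite vol0 ?subr_ge0 ?tq// lee_fin mulrAC -[leLHS]mul1r ler_wpM2r ?(ltW V0)//.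
    exact: expR_le_slice.
  rewrite /psum_vol /= /psum big_ord0 subr_ge0 tq (lt_geF t1) /= lee_fin.
  by rewrite !mulr_ge0 ?expR_ge0 ?(ltW V0).
have n0 : 0 < n.+1%:R :> R by [].
(* The ball now has dimension [m + 1] and the slices dimension [m = n.+1]. For [|t| <= a] the
   threshold is at least [m/(m+1) >= e^(-1/m)], and the power [m/q] leaves [e^(-1/q) >= e^-1]. *)
split => [ta|].
  have tq : `|t| `^ q <= n.+2%:R^-1 by rewrite -aq ge0_ler_powR ?nnegrE ?(ltW q0) ?(ltW a0).
  have h : n.+1%:R / n.+2%:R <= 1 - `|t| `^ q.
    rewrite (_ : n.+1%:R / n.+2%:R = 1 - n.+2%:R^-1); first by rewrite lerD2l lerN2.
    by apply: (mulIf (x := n.+2%:R)); rewrite ?mulrBl ?mul1r ?mulVf ?divfK ?pnatr_eq0// -(natr1 n.+1) addrK.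
  apply: le_trans (psum_vol_le _ _ h); rewrite psum_vol_scale ?divr_gt0// VE.
  rewrite -EFinM lee_fin ler_wpM2r ?(ltW V0)//.
  have e1 : expR (- n.+1%:R^-1) <= n.+1%:R / n.+2%:R :> R.
    rewrite expRN -[leRHS]invf_div lef_pV2 ?posrE ?expR_gt0 ?divr_gt0//.
    apply: le_trans (expR_ge1Dx _).
    by rewrite -(natr1 n.+1) mulrDl divff ?gt_eqF// mul1r.
  apply: (@le_trans _ _ (expR (- n.+1%:R^-1) `^ (n.+1%:R / q))); last first.
    by rewrite ge0_ler_powR ?divr_ge0 ?nnegrE ?expR_ge0 ?(ltW q0).
  rewrite -expRM ler_expR mulNr mulKf ?gt_eqF// lerN2.
  by rewrite invf_le1.
(* Enlarging the threshold by [1 - s <= e^-s] makes it positive, so that the scaling formula applies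
   even when [|t| > 1]. *)
apply: (@le_trans _ _ (psum_vol n.+1 q (expR (- (`|t| `^ q))))).
  by apply: psum_vol_le; exact: expR_ge1Dx.
rewrite psum_vol_scale ?expR_gt0// VE -EFinM lee_fin -expRM.
rewrite mulrAC ler_wpM2r ?(ltW V0)// -expRD ler_expR.
pose y := `|t| / a.
have y0 : 0 <= y by rewrite divr_ge0// ltW.
have tE : `|t| = a * y by rewrite /y mulrC divfK ?gt_eqF.
clearbody y; have := le_powR_div q1 y0.
rewrite tE powRM ?(ltW a0)// aq.
have -> : - (2 * a)^-1 * (a * y) = - (y / 2) by field; rewrite gt_eqF.
set P := y `^ q / q => yP.
have -> : - (n.+2%:R^-1 * y `^ q) * (n.+1%:R / q) = - ((n.+1%:R / n.+2%:R) * P).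
  by rewrite /P; ring.
have P0 : 0 <= P by rewrite divr_ge0 ?powR_ge0// ltW.
(* With [|t| = a y] the exponent is [-(n+1)/(n+2) P], which is at most [-P/2]; then [P >= y - 1]
   gives [1/2 - y/2], whence the factor [e^(1/2)] in the upper slice bound. *)
have : 2^-1 * P <= (n.+1%:R / n.+2%:R) * P.
  rewrite ler_wpM2r// ler_pdivlMr// mulrC ler_pdivrMr// -natrM ler_nat.
  by rewrite muln2 doubleS !ltnS -addnn leq_addr.
by move: yP; set c := _ / _ * P; clearbody c; lra.
Qed.

Lemma slice_bounds_inf n : slice_bounds (@ball_ind R n.+1 +oo%E) 1 ((2 * 1) ^+ n).
Proof.
move=> i t.
have E : iint (fun z => (ball_ind +oo%E (vinsert i t z))%:E) =
    ((`|t| <= 1)%R%:R * (2 * 1) ^+ n)%:E.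
  rewrite EFinM -iint_box// -iintZ//.
  - congr iint; apply/funext => z; rewrite ball_ind_inf -EFinM; congr EFin.
    rewrite (bigD1_ord i)//= /vinsert unlift_none; congr (_ * _).
    by apply: eq_bigr => j _; rewrite liftK.
  - by move=> z; rewrite lee_fin prodr_ge0.
  - apply: rmeasurable_vmeasurable; apply: rmeasurable_prod => j.
    apply: rmeasurable_le; last exact: rmeasurable_cst.
    by apply: (rmeasurable_coord j (phi := Num.norm)); exact: normr_measurable.
have V0 : 0 <= (2 * 1) ^+ n :> R by rewrite exprn_ge0.
rewrite E; split => [t1|].
  by rewrite t1 lee_fin ler_wpM2r// expRN1_le1.
rewrite lee_fin mulrAC ler_wpM2r//; case: (leP `|t| 1) => t1.
  exact: expR_le_slice.
by rewrite mulr_ge0 ?expR_ge0.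
Qed.

Lemma lpball_slice_bounds n (p : \bar R) : (1 <= p)%E ->
  exists2 V : R, 0 < V & slice_bounds (@ball_ind R n.+1 p) (dpow n.+1 p)^-1 V.
Proof.
case: p => [q| |]// q1.
  have [V V0 VE] := psum_vol1_bounds n (q1 : 1 <= q).
  by exists V => //; exact: slice_bounds_fin.
by exists ((2 * 1) ^+ n); [rewrite exprn_gt0|rewrite /= invr1; exact: slice_bounds_inf].
Qed.

End LpBallSlices.

(** * Duality of the norms *)

Section LinearForms.
Variable R : realType.

(** Each constant is a quotient, a moment bound over a mass bound: [moment2_ge] over [mass_le] here,
    [moment4_le] over [mass_ge] for [moment4_cst]. *)
Definition moment2_cst : R := expR (- 1) / (32 * expR 2^-1).
Definition moment4_cst : R := 4 * 16 ^+ 4 * expR 2^-1 / expR (- 1).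

Lemma moment2_cst_gt0 : 0 < moment2_cst.
Proof. by rewrite divr_gt0 ?mulr_gt0 ?expR_gt0. Qed.

Lemma moment4_cst_gt0 : 0 < moment4_cst.
Proof. by rewrite divr_gt0 ?mulr_gt0 ?exprn_gt0 ?expR_gt0. Qed.

Variables (n : nat) (b : ('I_n.+1 -> R) -> R) (a V : R).
Hypotheses (b0 : forall z, 0 <= b z) (mb : rmeasurable b).
Hypotheses (bflip : forall i z, b (vflip i z) = b z).
Hypotheses (bsupp : forall z, b z != 0 -> forall i, `|z i| <= 1).
Hypotheses (a0 : 0 < a) (V0 : 0 < V) (sb : slice_bounds b a V).

(** An unnormalized expectation: dividing by the mass [D] gives the mean over the ball. The value is
    meaningful for nonnegative [F] satisfying [bmeasurable], by [bintegralE]. *)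
Definition bintegral (F : ('I_n.+1 -> R) -> R) : R := fine (iint (fun z => (b z * F z)%:E)).
Local Notation m := bintegral.

(** Boundedness is asked only where the weight is nonzero, so that polynomials in the coordinates
    qualify; together with the finite mass it makes their integrals finite. *)
Definition bmeasurable (F : ('I_n.+1 -> R) -> R) :=
  rmeasurable F /\ exists K, forall z, b z != 0 -> `|F z| <= K.

Lemma bmeasurableD F G : bmeasurable F -> bmeasurable G ->
  bmeasurable (fun z => F z + G z).
Proof.
move=> [mF [K FK]] [mG [L GL]]; split; first exact: rmeasurableD.
exists (K + L) => z bz; apply: le_trans (ler_normD _ _) _.
by rewrite lerD ?FK ?GL.
Qed.

Lemma bmeasurableM F G : bmeasurable F -> bmeasurable G ->
  bmeasurable (fun z => F z * G z).
Proof.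
move=> [mF [K FK]] [mG [L GL]]; split; first exact: rmeasurableM.
by exists (K * L) => z bz; rewrite normrM ler_pM ?FK ?GL.
Qed.

Lemma bmeasurable_cst c : bmeasurable (fun=> c).
Proof. by split; [exact: rmeasurable_cst|exists `|c|]. Qed.

Lemma bmeasurableX F k : bmeasurable F -> bmeasurable (fun z => F z ^+ k).
Proof.
move=> [mF [K FK]]; split; first exact: rmeasurableX.
exists (K ^+ k) => z bz; rewrite normrX lerXn2r ?nnegrE ?FK//.
exact: le_trans (FK _ bz).
Qed.

Lemma bmeasurable_coord i : bmeasurable (fun z => z i).
Proof.
split; first by apply: (rmeasurable_coord i (phi := id)); exact: measurable_id.
by exists 1 => z bz; exact: bsupp.
Qed.

Lemma bmeasurable_bool (P : ('I_n.+1 -> R) -> bool) :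
  rmeasurable (fun z => (P z)%:R) -> bmeasurable (fun z => (P z)%:R).
Proof.
by move=> mP; split=> //; exists 1 => z _; case: (P z); rewrite ?normr1 ?normr0.
Qed.

Lemma bmeasurable_vflip i F : bmeasurable F -> bmeasurable (fun z => F (vflip i z)).
Proof.
move=> [mF [K FK]]; split; last by exists K => z bz; apply: FK; rewrite bflip.
by apply/measurable_EFinP; exact: (vmeasurable_vflip i (rmeasurable_vmeasurable mF)).
Qed.

Lemma bintegralE F : bmeasurable F -> (forall z, 0 <= F z) ->
  iint (fun z => (b z * F z)%:E) = (m F)%:E.
Proof.
move=> [mF [K FK]] F0; rewrite fineK// ge0_fin_numE; last first.
  by apply: iint_ge0 => z; rewrite lee_fin mulr_ge0.
pose K' := Num.max K 0.
apply: (@le_lt_trans _ _ (iint (fun z => K'%:E * (b z)%:E)))%E.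
  apply: le_iint => z; rewrite ?lee_fin ?mulr_ge0// mulrC.
  have [->|bz] := eqVneq (b z) 0; first by rewrite !mulr0.
  rewrite ler_wpM2r// (le_trans (ler_norm _))// (le_trans (FK _ bz))//.
  by rewrite le_max lexx.
rewrite iintZ ?le_max ?lexx ?orbT//; last exact: rmeasurable_vmeasurable.
  apply: (le_lt_trans (lee_pmul _ _ (lexx _) (mass_le b0 mb a0 V0 sb))).
  - by rewrite lee_fin le_max lexx orbT.
  - by apply: iint_ge0 => z; rewrite lee_fin.
  by rewrite -EFinM ltry.
Qed.

Lemma bintegral_ge0 F : (forall z, 0 <= F z) -> 0 <= m F.
Proof.
by move=> F0; apply: fine_ge0; apply: iint_ge0 => z; rewrite lee_fin mulr_ge0.
Qed.

Lemma ler_bintegral F G : bmeasurable F -> bmeasurable G ->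
  (forall z, 0 <= F z) -> (forall z, F z <= G z) -> m F <= m G.
Proof.
move=> mF mG F0 FG; rewrite -lee_fin -!bintegralE// => [|z].
  by apply: le_iint => z; rewrite lee_fin ?mulr_ge0// ler_wpM2l.
exact: le_trans (FG z).
Qed.

Lemma bintegralD F G : bmeasurable F -> bmeasurable G ->
  (forall z, 0 <= F z) -> (forall z, 0 <= G z) ->
  m (fun z => F z + G z) = m F + m G.
Proof.
move=> mF mG F0 G0; apply: EFin_inj; rewrite EFinD -!bintegralE//; last 2 first.
- exact: bmeasurableD.
- by move=> z; rewrite addr_ge0.
rewrite -iintD.
- by congr iint; apply/funext => z; rewrite mulrDr EFinD.
- by move=> z; rewrite lee_fin mulr_ge0.
- by apply: rmeasurable_vmeasurable; exact: rmeasurableM mF.1.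
- by move=> z; rewrite lee_fin mulr_ge0.
- by apply: rmeasurable_vmeasurable; exact: rmeasurableM mG.1.
Qed.

Lemma bintegralZ c F : 0 <= c -> bmeasurable F -> (forall z, 0 <= F z) ->
  m (fun z => c * F z) = c * m F.
Proof.
move=> c0 mF F0; apply: EFin_inj; rewrite EFinM -!bintegralE//; last 2 first.
- by apply: bmeasurableM => //; exact: bmeasurable_cst.
- by move=> z; rewrite mulr_ge0.
rewrite -iintZ//.
- by congr iint; apply/funext => z; rewrite -EFinM mulrCA.
- by move=> z; rewrite lee_fin mulr_ge0.
- by apply: rmeasurable_vmeasurable; exact: rmeasurableM mF.1.
Qed.

Lemma bintegral_vflip i F : bmeasurable F -> (forall z, 0 <= F z) ->
  m (fun z => F (vflip i z)) = m F.
Proof.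
move=> mF F0; congr fine.
rewrite -[RHS](iint_vflip i).
- by congr iint; apply/funext => z; rewrite bflip.
- by move=> z; rewrite lee_fin mulr_ge0.
- by apply: rmeasurable_vmeasurable; exact: rmeasurableM mF.1.
Qed.

(** Additivity is established for nonnegative functions only, so odd terms are never integrated by
    themselves: [F] is averaged with its reflection, which cancels them pointwise and leaves [G]. *)
Lemma bintegral_even i F G : bmeasurable F -> bmeasurable G -> (forall z, 0 <= F z) ->
  (forall z, 0 <= G z) -> (forall z, F z + F (vflip i z) = 2 * G z) -> m F = m G.
Proof.
move=> mF mG F0 G0 FG.
have h : m F + m F = 2 * m G.
  rewrite -{2}(bintegral_vflip i mF F0) -bintegralD//; last exact: bmeasurable_vflip.
  rewrite -bintegralZ//; congr m; exact/funext.
by move: h; lra.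
Qed.

Lemma bmeasurable_bigsum (I : Type) (s : seq I) (P : pred I) (F : I -> ('I_n.+1 -> R) -> R) :
  (forall i, bmeasurable (F i)) -> bmeasurable (fun z => \sum_(i <- s | P i) F i z).
Proof.
move=> mF; elim: s => [|i s IH].
  by under eq_fun do rewrite big_nil; exact: bmeasurable_cst.
under eq_fun do rewrite big_cons; case: (P i) => //.
exact: bmeasurableD.
Qed.

Lemma bintegral_bigsum (I : Type) (s : seq I) (P : pred I) (F : I -> ('I_n.+1 -> R) -> R) :
  (forall i, bmeasurable (F i)) -> (forall i z, 0 <= F i z) ->
  m (fun z => \sum_(i <- s | P i) F i z) = \sum_(i <- s | P i) m (F i).
Proof.
move=> mF F0; elim: s => [|i s IH].
  rewrite big_nil; transitivity (m (fun=> 0 * 1)).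
    by congr m; apply/funext => z; rewrite big_nil mul0r.
  by rewrite bintegralZ// ?mul0r//; exact: bmeasurable_cst.
rewrite big_cons -IH; case: ifP => Pi.
  rewrite -bintegralD//.
  - by congr m; apply/funext => z; rewrite big_cons Pi.
  - exact: bmeasurable_bigsum.
  - by move=> z; rewrite sumr_ge0.
by congr m; apply/funext => z; rewrite big_cons Pi.
Qed.

Local Notation D := (m (fun=> 1)).

Lemma bmass_bounds : 2 * expR (- 1) * (a * V) <= D <= 4 * expR 2^-1 * (a * V).
Proof.
rewrite -!lee_fin -bintegralE//; last exact: bmeasurable_cst.
rewrite (_ : (fun z => _) = (fun z => (b z)%:E)); last by apply/funext => z; rewrite mulr1.
by rewrite (mass_ge b0 mb a0 V0 sb) (mass_le b0 mb a0 V0 sb).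
Qed.

Lemma bmass_gt0 : 0 < D.
Proof.
by have /andP[h _] := bmass_bounds; rewrite (lt_le_trans _ h)// !mulr_gt0// expR_gt0.
Qed.

Lemma coord2_ge i : moment2_cst * a ^+ 2 * D <= m (fun z => z i ^+ 2).
Proof.
have h : expR (- 1) / 8 * (a ^+ 3 * V) <= m (fun z => z i ^+ 2).
  rewrite -lee_fin -bintegralE//.
  - exact: (moment2_ge b0 mb a0 V0 sb).
  - by apply: bmeasurableX; exact: bmeasurable_coord.
  - by move=> z; exact: sqr_ge0.
apply: le_trans h; have /andP[_ hD] := bmass_bounds.
have -> : expR (- 1) / 8 * (a ^+ 3 * V) = moment2_cst * a ^+ 2 * (4 * expR 2^-1 * (a * V)).
  by rewrite /moment2_cst; field; rewrite gt_eqF ?expR_gt0.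
by rewrite ler_wpM2l// mulr_ge0 ?sqr_ge0// ltW// moment2_cst_gt0.
Qed.

Lemma coord4_le i : m (fun z => z i ^+ 4) <= moment4_cst * a ^+ 4 * D.
Proof.
have h : m (fun z => z i ^+ 4) <= 8 * 16 ^+ 4 * expR 2^-1 * (a ^+ 5 * V).
  rewrite -lee_fin -bintegralE//.
  - exact: (moment4_le b0 mb a0 V0 sb).
  - by apply: bmeasurableX; exact: bmeasurable_coord.
  - by move=> z; rewrite exprn_even_ge0.
apply: (le_trans h); have /andP[hD _] := bmass_bounds.
have -> : 8 * 16 ^+ 4 * expR 2^-1 * (a ^+ 5 * V) =
    moment4_cst * a ^+ 4 * (2 * expR (- 1) * (a * V)).
  by rewrite /moment4_cst; field; rewrite gt_eqF ?expR_gt0.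
by rewrite ler_wpM2l// mulr_ge0 ?exprn_even_ge0// ltW// moment4_cst_gt0.
Qed.

(** By the arithmetic-geometric mean inequality [z^2 <= z^4/(2a^2) + a^2/2], the fourth-moment bound
    already controls the second moment. *)
Lemma coord2_le i : m (fun z => z i ^+ 2) <= (moment4_cst + 1) / 2 * a ^+ 2 * D.
Proof.
have b4 : bmeasurable (fun z => z i ^+ 4) by apply: bmeasurableX; exact: bmeasurable_coord.
have b1 := bmeasurable_cst 1.
have z4 (z : 'I_n.+1 -> R) : 0 <= z i ^+ 4 by rewrite exprn_even_ge0.
have c0 : 0 <= (2 * a ^+ 2)^-1 by rewrite invr_ge0 mulr_ge0 ?sqr_ge0.
have c1 : 0 <= a ^+ 2 / 2 by rewrite divr_ge0 ?sqr_ge0.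
apply: (@le_trans _ _ (m (fun z => (2 * a ^+ 2)^-1 * z i ^+ 4 + a ^+ 2 / 2 * 1))).
  apply: ler_bintegral.
  - by apply: bmeasurableX; exact: bmeasurable_coord.
  - by apply: bmeasurableD; apply: bmeasurableM => //; exact: bmeasurable_cst.
  - by move=> z; exact: sqr_ge0.
  - move=> z; rewrite -subr_ge0.
    have -> : (2 * a ^+ 2)^-1 * z i ^+ 4 + a ^+ 2 / 2 * 1 - z i ^+ 2 =
       (2 * a ^+ 2)^-1 * (z i ^+ 2 - a ^+ 2) ^+ 2 by field; rewrite gt_eqF.
    by rewrite mulr_ge0 ?sqr_ge0.
rewrite bintegralD; last 4 first.
- by apply: bmeasurableM => //; exact: bmeasurable_cst.
- by apply: bmeasurableM => //; exact: bmeasurable_cst.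
- by move=> z; rewrite mulr_ge0.
- by move=> z; rewrite mulr_ge0.
rewrite !bintegralZ//.
have := ler_wpM2l c0 (coord4_le i).
rewrite (_ : (2 * a ^+ 2)^-1 * (moment4_cst * a ^+ 4 * D) = moment4_cst / 2 * a ^+ 2 * D); last by field; rewrite gt_eqF.
lra.
Qed.

(** The sum runs over a sequence of indices so that inductions can split off one coordinate, whose
    reflection fixes the rest of the form. *)
Definition lform (u : 'I_n.+1 -> R) (s : seq 'I_n.+1) (z : 'I_n.+1 -> R) : R :=
  \sum_(i <- s) u i * z i.

Lemma bmeasurable_lform u s : bmeasurable (lform u s).
Proof.
rewrite /lform; elim: s => [|i s IH].
  by under eq_fun do rewrite big_nil; exact: bmeasurable_cst.
under eq_fun do rewrite big_cons.
apply: bmeasurableD => //; apply: bmeasurableM; first exact: bmeasurable_cst.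
exact: bmeasurable_coord.
Qed.

Lemma lform_vflip u s i z : i \notin s -> lform u s (vflip i z) = lform u s z.
Proof.
move=> si; apply: eq_big_seq => j js; rewrite /vflip.
by case: eqP => // ji; move: si; rewrite -ji js.
Qed.

Lemma vflip_self i (z : 'I_n.+1 -> R) : vflip i z i = - z i.
Proof. by rewrite /vflip eqxx. Qed.

(* The cross terms of the square vanish because the ball and the weight are
   invariant under each coordinate reflection. *)
Lemma bintegral_lform2 (u : 'I_n.+1 -> R) s G : uniq s -> bmeasurable G -> (forall z, 0 <= G z) ->
  (forall i z, G (vflip i z) = G z) ->
  m (fun z => G z * lform u s z ^+ 2) = \sum_(i <- s) u i ^+ 2 * m (fun z => G z * z i ^+ 2).
Proof.
move=> us mG G0 Gf; elim: s us => [_|i s IH /andP[si us]].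
  rewrite big_nil; transitivity (m (fun=> 0 * 1)).
    by congr m; apply/funext => z; rewrite /lform big_nil expr0n mul0r mulr0.
  by rewrite bintegralZ// ?mul0r//; exact: bmeasurable_cst.
have mz : bmeasurable (fun z => G z * z i ^+ 2).
  by apply: bmeasurableM => //; apply: bmeasurableX; exact: bmeasurable_coord.
have ms : bmeasurable (fun z => G z * lform u s z ^+ 2).
  by apply: bmeasurableM => //; apply: bmeasurableX; exact: bmeasurable_lform.
have muz : bmeasurable (fun z => u i ^+ 2 * (G z * z i ^+ 2)).
  by apply: bmeasurableM => //; exact: bmeasurable_cst.
rewrite big_cons -IH// -bintegralZ ?sqr_ge0//; last by move=> z; rewrite mulr_ge0 ?sqr_ge0.
rewrite -bintegralD//; last 2 first.
- by move=> z; exact: (mulr_ge0 (sqr_ge0 _) (mulr_ge0 (G0 z) (sqr_ge0 _))).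
- by move=> z; exact: (mulr_ge0 (G0 z) (sqr_ge0 _)).
apply: (@bintegral_even i).
- by apply: bmeasurableM => //; apply: bmeasurableX; exact: bmeasurable_lform.
- exact: bmeasurableD.
- by move=> z; rewrite mulr_ge0 ?sqr_ge0.
- move=> z; apply: addr_ge0.
    exact: (mulr_ge0 (sqr_ge0 _) (mulr_ge0 (G0 z) (sqr_ge0 _))).
  exact: (mulr_ge0 (G0 z) (sqr_ge0 _)).
move=> z; rewrite Gf {1 2}/lform !big_cons -!/(lform u s _) lform_vflip// vflip_self.
ring.
Qed.

(** Write the form as [u_i z_i + S]. Averaging its fourth power over the reflection in [i] leaves
    [u_i^4 z_i^4 + 6 u_i^2 z_i^2 S^2 + S^4]. The middle term is expanded by [bintegral_lform2] with
    weight [z_i^2], and each mixed moment of [z_i^2 z_j^2] is at most [M]. With [U] the sum of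
    squares in [S], the bound [M (u_i^4 + 6 u_i^2 U + 3 U^2)] falls short of [3 M (u_i^2 + U)^2] by
    [2 M u_i^4], which closes the induction. *)
Lemma bintegral_lform4 (u : 'I_n.+1 -> R) s : uniq s ->
  m (fun z => lform u s z ^+ 4) <= 3 * (moment4_cst * a ^+ 4 * D) * (\sum_(i <- s) u i ^+ 2) ^+ 2.
Proof.
set M := moment4_cst * a ^+ 4 * D.
have mz i k : bmeasurable (fun z => z i ^+ k).
  by apply: bmeasurableX; exact: bmeasurable_coord.
have z4 (x : R) : 0 <= x ^+ 4 by rewrite exprn_even_ge0.
have crossM i j : m (fun z => z i ^+ 2 * z j ^+ 2) <= M.
  apply: (@le_trans _ _ (m (fun z => 2^-1 * z i ^+ 4 + 2^-1 * z j ^+ 4))).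
    apply: ler_bintegral.
    - exact: bmeasurableM.
    - by apply: bmeasurableD; apply: bmeasurableM => //; exact: bmeasurable_cst.
    - by move=> z; rewrite mulr_ge0 ?sqr_ge0.
    - move=> z; rewrite -subr_ge0.
      rewrite (_ : _ - _ = 2^-1 * (z i ^+ 2 - z j ^+ 2) ^+ 2); last by field.
      by rewrite mulr_ge0 ?sqr_ge0.
  rewrite bintegralD ?bintegralZ//; last 4 first.
  - by apply: bmeasurableM => //; exact: bmeasurable_cst.
  - by apply: bmeasurableM => //; exact: bmeasurable_cst.
  - by move=> z; rewrite mulr_ge0.
  - by move=> z; rewrite mulr_ge0.
  by have := coord4_le i; have := coord4_le j; rewrite -/M; lra.
elim: s => [_|i s IH /andP[si us]].
  rewrite big_nil [X in X <= _](_ : _ = m (fun=> 0 * 1)).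
    by rewrite bintegralZ// ?mul0r ?expr0n ?mulr0//; exact: bmeasurable_cst.
  by congr m; apply/funext => z; rewrite /lform big_nil expr0n mul0r.
have mS k : bmeasurable (fun z => lform u s z ^+ k).
  by apply: bmeasurableX; exact: bmeasurable_lform.
have mc c F : bmeasurable F -> bmeasurable (fun z => c * F z).
  by move=> mF; apply: bmeasurableM => //; exact: bmeasurable_cst.
have mzS : bmeasurable (fun z => z i ^+ 2 * lform u s z ^+ 2) by exact: bmeasurableM.
have zS0 z : 0 <= z i ^+ 2 * lform u s z ^+ 2 by rewrite mulr_ge0 ?sqr_ge0.
have u60 : 0 <= 6 * u i ^+ 2 by rewrite mulr_ge0 ?sqr_ge0.
have -> : m (fun z => lform u (i :: s) z ^+ 4) =
  u i ^+ 4 * m (fun z => z i ^+ 4) +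
  (6 * u i ^+ 2 * m (fun z => z i ^+ 2 * lform u s z ^+ 2) + m (fun z => lform u s z ^+ 4)).
  have pA z : 0 <= u i ^+ 4 * z i ^+ 4 by exact: mulr_ge0.
  have pB z : 0 <= 6 * u i ^+ 2 * (z i ^+ 2 * lform u s z ^+ 2) by exact: mulr_ge0.
  have pC z : 0 <= 6 * u i ^+ 2 * (z i ^+ 2 * lform u s z ^+ 2) + lform u s z ^+ 4.
    exact: addr_ge0.
  have mA := mc (u i ^+ 4) _ (mz i 4).
  have mB := mc (6 * u i ^+ 2) _ mzS.
  have mC := bmeasurableD mB (mS 4).
  rewrite -!bintegralZ// -!bintegralD//.
  apply: (@bintegral_even i) => //.
  - by apply: bmeasurableX; exact: bmeasurable_lform.
  - exact: bmeasurableD.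
  - by move=> z; exact: addr_ge0.
  move=> z; rewrite {1 2}/lform !big_cons -!/(lform u s _) lform_vflip// vflip_self.
  ring.
have -> : m (fun z => z i ^+ 2 * lform u s z ^+ 2) =
    \sum_(j <- s) u j ^+ 2 * m (fun z => z i ^+ 2 * z j ^+ 2).
  apply: bintegral_lform2 => // [z|j z]; first exact: sqr_ge0.
  by rewrite /vflip; case: eqP => _; rewrite ?sqrrN.
have := IH us; rewrite big_cons.
have : \sum_(j <- s) u j ^+ 2 * m (fun z => z i ^+ 2 * z j ^+ 2) <= (\sum_(j <- s) u j ^+ 2) * M.
  by rewrite mulr_suml; apply: ler_sum => j _; rewrite ler_wpM2l ?sqr_ge0.
set X := \sum_(j <- s) _ * _; set U := \sum_(j <- s) _ => hX hS.
have h1 : u i ^+ 4 * m (fun z => z i ^+ 4) <= u i ^+ 4 * M.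
  by rewrite ler_wpM2l// coord4_le.
have h2 : 6 * u i ^+ 2 * X <= 6 * u i ^+ 2 * (U * M) by rewrite ler_wpM2l.
have M0 : 0 <= M by apply: le_trans (crossM i i); apply: bintegral_ge0 => z; rewrite mulr_ge0 ?sqr_ge0.
apply: (le_trans (lerD h1 (lerD h2 hS))).
rewrite -subr_ge0 (_ : _ - _ = 2 * (u i ^+ 4 * M)); last by ring.
exact: (mulr_ge0 (ler0n _ 2) (mulr_ge0 (z4 _) M0)).
Qed.

(** * Chebyshev and Paley-Zygmund bounds for a linear form *)

Section Tails.
Variable u : 'I_n.+1 -> R.
Let X := lform u (index_enum 'I_n.+1).
Let U := \sum_i u i ^+ 2.

Let mX k : bmeasurable (fun z => X z ^+ k).
Proof. by apply: bmeasurableX; exact: bmeasurable_lform. Qed.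

Let X2E : m (fun z => X z ^+ 2) = \sum_i u i ^+ 2 * m (fun z => z i ^+ 2).
Proof.
have := @bintegral_lform2 u (index_enum 'I_n.+1) (fun=> 1) (index_enum_uniq _)
  (bmeasurable_cst 1) (fun _ => ler01) (fun _ _ => erefl).
rewrite [in LHS](_ : (fun z => 1 * _) = (fun z => X z ^+ 2)); last first.
  by apply/funext => z; rewrite mul1r.
move=> ->; apply: eq_bigr => i _; congr (_ * m _).
by apply/funext => z; rewrite mul1r.
Qed.

Let mbool (P : ('I_n.+1 -> R) -> bool) c :
  rmeasurable (fun z => (P z)%:R) -> bmeasurable (fun z => c * (P z)%:R).
Proof.
by move=> mP; apply: bmeasurableM; [exact: bmeasurable_cst|exact: bmeasurable_bool].
Qed.

Lemma chebyshev_lform (t : R) : 0 < t ->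
  m (fun z => (t <= `|X z|)%R%:R) <= (moment4_cst + 1) / 2 * a ^+ 2 * U / t ^+ 2 * D.
Proof.
move=> t0.
have mP : rmeasurable (fun z => (t <= `|X z|)%R%:R).
  apply: rmeasurable_le; first exact: rmeasurable_cst.
  exact: (measurableT_comp (@normr_measurable R setT) (bmeasurable_lform u _).1).
have h : t ^+ 2 * m (fun z => (t <= `|X z|)%R%:R) <= m (fun z => X z ^+ 2).
  rewrite -bintegralZ ?sqr_ge0//; last exact: bmeasurable_bool.
  apply: ler_bintegral => //; first exact: mbool.
  - by move=> z; rewrite mulr_ge0 ?sqr_ge0.
  move=> z; case: (leP t `|X z|) => tX; last by rewrite mulr0 sqr_ge0.
  by rewrite mulr1 -(real_normK (num_real (X z))) lerXn2r ?nnegrE ?(ltW t0).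
have h2 : m (fun z => X z ^+ 2) <= (moment4_cst + 1) / 2 * a ^+ 2 * U * D.
  rewrite X2E mulrAC mulr_sumr; apply: ler_sum => i _.
  by rewrite mulrC ler_wpM2r ?sqr_ge0// coord2_le.
rewrite mulrAC ler_pdivlMr ?exprn_gt0// mulrC.
exact: le_trans h h2.
Qed.

(* Paley-Zygmund: integrate X^2 <= theta + lam X^4 / 2 + 1_{theta < X^2} / (2 lam)
   with the optimal lam. *)
Lemma paley_zygmund_lform (theta delta : R) : 0 <= theta -> 0 < delta -> 0 < U ->
  theta + delta <= moment2_cst * a ^+ 2 * U ->
  delta ^+ 2 / (3 * moment4_cst * a ^+ 4 * U ^+ 2) * D <= m (fun z => (theta < X z ^+ 2)%R%:R).
Proof.
move=> th0 d0 U0 td.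
have mP : rmeasurable (fun z => (theta < X z ^+ 2)%R%:R).
  by apply: rmeasurable_lt; [exact: rmeasurable_cst|exact: (mX 2).1].
set P := m (fun z => (theta < _)%R%:R).
set K := 3 * moment4_cst * a ^+ 4 * U ^+ 2.
have K0 : 0 < K by rewrite !mulr_gt0 ?exprn_gt0 ?moment4_cst_gt0.
(* This value bounds the fourth-moment term by [delta/2 D], half of the gap [delta D], and leaves
   the other half for the probability term. *)
pose lam := delta / K.
have l0 : 0 < lam by rewrite divr_gt0.
have D0 := bmass_gt0.
have h4 : m (fun z => X z ^+ 4) <= K * D.
  have := @bintegral_lform4 u (index_enum 'I_n.+1) (index_enum_uniq _).
  by rewrite /K => /le_trans; apply; rewrite le_eqVlt; apply/orP; left; apply/eqP; rewrite -/U; ring.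
have h2 : (theta + delta) * D <= m (fun z => X z ^+ 2).
  apply: (@le_trans _ _ (moment2_cst * a ^+ 2 * U * D)); first by rewrite ler_wpM2r// ltW.
  rewrite X2E mulrAC mulr_sumr; apply: ler_sum => i _.
  by rewrite [leRHS]mulrC ler_wpM2r ?sqr_ge0// coord2_ge.
have c1 : 0 <= lam / 2 by rewrite divr_ge0// ltW.
have c2 : 0 <= (2 * lam)^-1 by rewrite invr_ge0 mulr_ge0// ltW.
have X40 z : 0 <= X z ^+ 4 by rewrite exprn_even_ge0.
have key : m (fun z => X z ^+ 2) <= theta * D + (lam / 2 * m (fun z => X z ^+ 4) + (2 * lam)^-1 * P).
  have m1 := bmeasurable_cst 1.
  have mc c F : bmeasurable F -> bmeasurable (fun z => c * F z).
    by move=> mF; apply: bmeasurableM => //; exact: bmeasurable_cst.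
  have mI := bmeasurable_bool mP.
  have pA z : 0 <= lam / 2 * X z ^+ 4 by exact: mulr_ge0.
  have pB z : 0 <= (2 * lam)^-1 * (theta < X z ^+ 2)%R%:R by exact: mulr_ge0.
  have pC z : 0 <= lam / 2 * X z ^+ 4 + (2 * lam)^-1 * (theta < X z ^+ 2)%R%:R.
    exact: addr_ge0.
  have p1 (z : 'I_n.+1 -> R) : 0 <= theta * 1 by rewrite mulr1.
  have mA := mc (lam / 2) _ (mX 4).
  have mB := mc (2 * lam)^-1 _ mI.
  have mC := bmeasurableD mA mB.
  have mD := mc theta _ m1.
  rewrite -!bintegralZ// -!bintegralD//.
  apply: ler_bintegral => //.
  - exact: bmeasurableD.
  - by move=> z; exact: sqr_ge0.
  move=> z; rewrite mulr1; case: (ltP theta (X z ^+ 2)) => tX; last first.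
    by rewrite mulr0 addr0 (le_trans tX)// lerDl mulr_ge0.
  rewrite mulr1; apply: (@le_trans _ _ (lam / 2 * X z ^+ 4 + (2 * lam)^-1)); last by rewrite lerDr.
  rewrite -subr_ge0 (_ : _ - _ = (2 * lam)^-1 * (lam * X z ^+ 2 - 1) ^+ 2); last first.
    by field; rewrite gt_eqF.
  by rewrite mulr_ge0 ?sqr_ge0.
have e1 : lam / 2 * m (fun z => X z ^+ 4) <= delta / 2 * D.
  apply: (le_trans (ler_wpM2l c1 h4)).
  by rewrite le_eqVlt; apply/orP; left; apply/eqP; rewrite /lam; field; rewrite gt_eqF.
have e2 : delta / 2 * D <= (2 * lam)^-1 * P by move: (le_trans h2 key) e1; lra.
have l20 : 0 < 2 * lam by rewrite mulr_gt0.
have := ler_wpM2l (ltW l20) e2; rewrite mulVKf ?gt_eqF//; apply: le_trans.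
by rewrite le_eqVlt; apply/orP; left; apply/eqP; rewrite /lam; field; rewrite gt_eqF.
Qed.

End Tails.

End LinearForms.

(** * Flip probabilities *)

Section Duality.
Variables (R : realType) (d : nat).
Implicit Types (p : \bar R) (u r z : 'rV[R]_d).

Definition dotp u r : R := \sum_i u ord0 i * r ord0 i.

Lemma dotpZr c u r : dotp u (c *: r) = c * dotp u r.
Proof.
by rewrite /dotp mulr_sumr; apply: eq_bigr => i _; rewrite mxE mulrCA.
Qed.

Lemma lpnorm_ge0 p z : 0 <= lpnorm p z.
Proof.
case: p => [q| |] /=; [exact: powR_ge0| |exact: lexx].
by elim/big_ind: _ => // x y x0 y0; rewrite le_max x0.
Qed.

Lemma psum_powR_ge0 (q : R) z : 0 <= \sum_i `|z ord0 i| `^ q.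
Proof. by apply: sumr_ge0 => i _; exact: powR_ge0. Qed.

Lemma lpnorm_powR (q : R) z : 0 < q -> lpnorm q%:E z `^ q = \sum_i `|z ord0 i| `^ q.
Proof.
by move=> q0; rewrite /= -powRrM mulVf ?gt_eqF// powRr1// psum_powR_ge0.
Qed.

Lemma lpnorm_gt0 p z : (1 <= p)%E -> z != 0 -> 0 < lpnorm p z.
Proof.
move=> p1 z0.
have [i zi] : exists i, z ord0 i != 0.
  apply/existsP; rewrite -[X in is_true X]negbK negb_exists; apply/negP => /forallP h.
  move/eqP : z0; apply; apply/rowP => i; rewrite mxE; apply/eqP.
  by have := h i; rewrite negbK.
case: p p1 => [q| |]//= q1.
  apply: powR_gt0; rewrite (bigD1 i)//=; apply: ltr_pwDl.
    by rewrite powR_gt0// normr_gt0.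
  by apply: sumr_ge0 => j _; exact: powR_ge0.
apply: (@lt_le_trans _ _ `|z ord0 i|); first by rewrite normr_gt0.
exact: (@le_bigmax _ _ _ 0 (fun i => `|z ord0 i|) i).
Qed.

Lemma lpnormZ p c z : (1 <= p)%E -> lpnorm p (c *: z) = `|c| * lpnorm p z.
Proof.
case: p => [q| |]//= q1.
  have q0 : 0 < q by apply: lt_le_trans ltr01 _.
  rewrite (_ : \sum_i _ = `|c| `^ q * \sum_i `|z ord0 i| `^ q); last first.
    by rewrite mulr_sumr; apply: eq_bigr => i _; rewrite mxE normrM powRM.
  by rewrite powRM ?powR_ge0 ?psum_powR_ge0// -powRrM mulfV ?gt_eqF// powRr1.
rewrite -[RHS]/( `|c| * _).
rewrite (big_morph ( *%R `|c|) (id1 := 0) (op1 := Num.max)).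
- by apply: eq_bigr => i _; rewrite mxE normrM.
- by move=> x y; rewrite maxr_pMr.
- by rewrite mulr0.
Qed.

Lemma conj_exp_finite (q q' : R) : 1 <= q -> 1 <= q' -> conj_exp q%:E q'%:E ->
  q^-1 + q'^-1 = 1 /\ (q' - 1) * q = q'.
Proof.
move=> q1 q'1 [_ [_ e]]; split => //.
have [q0 q'0] : q != 0 /\ q' != 0 by split; apply/eqP; lra.
have : (q^-1 + q'^-1) * (q * q') = q * q' by rewrite e mul1r.
rewrite (_ : _ * (q * q') = q' + q); last by field; rewrite q0 q'0.
by move=> h; rewrite mulrBl mul1r mulrC -h; ring.
Qed.

(** Hölder's inequality. For finite exponents Young's inequality is summed over the coordinates of
    the normalized vectors, zero vectors being set aside first. If one exponent is infinite, the
    other equals 1 and each coordinate is bounded by the maximum. *)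
Lemma dotp_le p p' u r : (1 <= p)%E -> (1 <= p')%E -> conj_exp p p' ->
  `|dotp u r| <= lpnorm p' u * lpnorm p r.
Proof.
have step (x y : 'I_d -> R) : `|\sum_i x i * y i| <= \sum_i `|x i| * `|y i|.
  by apply: le_trans (ler_norm_sum _ _ _) _; apply: ler_sum => i _; rewrite normrM.
have l1 z : lpnorm 1%:E z = \sum_i `|z ord0 i|.
  rewrite /= invr1 powRr1 ?psum_powR_ge0//.
  by apply: eq_bigr => i _; rewrite powRr1.
have inv1E (q : R) : q^-1 = 1 -> q = 1 by move=> h; rewrite -[q]invrK h invr1.
have linf z i : `|z ord0 i| <= lpnorm +oo%E z.
  exact: (@le_bigmax _ _ _ 0 (fun i => `|z ord0 i|) i).
case: p p' => [q| |] [q'| |]//.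
- move=> q1 q'1 cj; have [e _] := conj_exp_finite q1 q'1 cj.
  have [q0 q'0] : 0 < q /\ 0 < q' by split; apply: lt_le_trans ltr01 _.
  have [u0|u0] := eqVneq u 0.
    by rewrite u0 /dotp big1 ?normr0 ?mulr_ge0 ?lpnorm_ge0// => i _; rewrite mxE mul0r.
  have [r0|r0] := eqVneq r 0.
    by rewrite r0 /dotp big1 ?normr0 ?mulr_ge0 ?lpnorm_ge0// => i _; rewrite mxE mulr0.
  have N0 := lpnorm_gt0 q'1 u0; have M0 := lpnorm_gt0 q1 r0.
  have uq := lpnorm_powR u q'0; have rq := lpnorm_powR r q0.
  set N := lpnorm q'%:E u in N0 uq *; set M := lpnorm q%:E r in M0 rq *; clearbody N M.
  apply: le_trans (step _ _) _.
  suff : \sum_i (`|u ord0 i| / N) * (`|r ord0 i| / M) <= 1.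
    rewrite (_ : \sum_i _ = (\sum_i `|u ord0 i| * `|r ord0 i|) / (N * M)); last first.
      by rewrite mulr_suml; apply: eq_bigr => i _; rewrite invfM mulrACA.
    by rewrite ler_pdivrMr ?mulr_gt0// mul1r.
  apply: (@le_trans _ _ (\sum_i ((`|u ord0 i| / N) `^ q' / q' + (`|r ord0 i| / M) `^ q / q))).
    apply: ler_sum => i _; apply: conjugate_powR => //; try by rewrite divr_ge0// ltW.
    by rewrite addrC.
  rewrite big_split /= -!mulr_suml.
  have inv1 (s : R) (y : 'rV[R]_d) (K : R) : 0 < K -> K `^ s = \sum_i `|y ord0 i| `^ s ->
      \sum_i (`|y ord0 i| / K) `^ s = 1.
    move=> K0 Ks; under eq_bigr => i _ do rewrite powRM ?invr_ge0 ?(ltW K0)//.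
    rewrite -mulr_suml -Ks -powRM ?invr_ge0 ?(ltW K0)// divff ?gt_eqF//.
    by rewrite powR1_1.
  by rewrite !inv1// !mul1r addrC e.
- move=> _ _ qi; rewrite (inv1E _ qi) l1; apply: le_trans (step _ _) _; rewrite mulr_sumr.
  by apply: ler_sum => i _; rewrite ler_wpM2r// linf.
- move=> _ _ qi; rewrite (inv1E _ qi) l1; apply: le_trans (step _ _) _; rewrite mulr_suml.
  by apply: ler_sum => i _; rewrite ler_wpM2l// linf.
Qed.

(** The equality case of Hölder. The extremal vector has coordinates [sg(u_i) (|u_i|/N)^(q'-1)] for
    finite exponents, is a signed basis vector at a largest coordinate of [u] for [p = 1], and is
    the vector of signs for infinite [p]. *)
Lemma dotp_attained p p' u : (1 <= p)%E -> (1 <= p')%E -> conj_exp p p' -> u != 0 ->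
  exists2 r, dotp u r = lpnorm p' u & lpnorm p r <= 1.
Proof.
move=> p1 p'1 cj u0; have N0 := lpnorm_gt0 p'1 u0.
have sgx (x : R) : x * Num.sg x = `|x| by rewrite mulrC -normrEsg.
case: p p' p1 p'1 cj N0 => [q| |] [q'| |]//.
- move=> q1 q'1 cj N0; have [e eq] := conj_exp_finite q1 q'1 cj.
  have [q0 q'0] : 0 < q /\ 0 < q' by split; apply: lt_le_trans ltr01 _.
  have uq := lpnorm_powR u q'0; set N := lpnorm q'%:E u in N0 uq *; clearbody N.
  exists (\row_i (Num.sg (u ord0 i) * (`|u ord0 i| / N) `^ (q' - 1))).
    rewrite /dotp.
    transitivity (\sum_i N * (`|u ord0 i| / N) `^ q').
      apply: eq_bigr => i _; rewrite mxE mulrA sgx.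
      rewrite -(@mulr_powRB1 _ (_ / _) q') ?divr_ge0 ?(ltW N0)// mulrA.
      by rewrite [N * _]mulrC divfK ?gt_eqF.
    rewrite -mulr_sumr; under eq_bigr => i _ do rewrite powRM ?invr_ge0 ?(ltW N0)//.
    by rewrite -mulr_suml -uq -powRM ?invr_ge0 ?(ltW N0)// divff ?gt_eqF// powR1_1 mulr1.
  rewrite /= -[leRHS](powR1_1 q^-1) ge0_ler_powR ?invr_ge0 ?nnegrE ?psum_powR_ge0 ?(ltW q0)//.
  apply: (@le_trans _ _ (\sum_i (`|u ord0 i| / N) `^ q')).
    apply: ler_sum => i _; rewrite mxE normrM (ger0_norm (powR_ge0 _ _)).
    rewrite powRM ?powR_ge0// -powRrM eq ler_piMl ?powR_ge0// normr_sg.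
    by case: (u ord0 i != 0); rewrite ?powR1_1 ?powR0 ?gt_eqF.
  under eq_bigr => i _ do rewrite powRM ?invr_ge0 ?(ltW N0)//.
  by rewrite -mulr_suml -uq -powRM ?invr_ge0 ?(ltW N0)// divff ?gt_eqF// powR1_1.
- move=> _ _ /= /(congr1 GRing.inv); rewrite invrK invr1 => -> N0.
  have [i Ni] : exists i, `|u ord0 i| = \big[Num.max/0]_i `|u ord0 i|.
    (* The positive norm rules out [d = 0], where the maximum would be the default [0] and attained
       at no index. *)
    have i0 : 'I_d.
      by move: N0; case: d u {u0} => [|d'] u; [rewrite big_ord0 ltxx|move=> _; exact: ord0].
    have [i _ ->] := @eq_bigmax _ _ _ 0 i0 xpredT (fun i => `|u ord0 i|) isT (fun i _ => normr_ge0 _).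
    by exists i.
  exists (\row_j (Num.sg (u ord0 i) * (j == i)%:R)).
    rewrite -Ni /dotp (bigD1 i)//= big1 ?addr0 => [|j ji]; rewrite mxE.
      by rewrite eqxx mulr1 sgx.
    by rewrite (negbTE ji) !mulr0.
  rewrite /= invr1 powRr1 ?psum_powR_ge0// (bigD1 i)//= big1 ?addr0 => [|j ji].
    rewrite mxE eqxx mulr1 powRr1// normr_sg.
    by case: (_ != _).
  by rewrite mxE (negbTE ji) mulr0 normr0 powRr1.
- move=> _ _ /= /(congr1 GRing.inv); rewrite invrK invr1 => -> _.
  exists (\row_j Num.sg (u ord0 j)).
    rewrite [RHS]/= invr1 powRr1 ?psum_powR_ge0//; apply: eq_bigr => i _.
    by rewrite mxE sgx powRr1.
  apply/bigmax_leP; split => // i _; rewrite mxE normr_sg.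
  by case: (_ != _).
Qed.

Lemma lpnorm2_sqr z : lpnorm 2%:E z ^+ 2 = \sum_i z ord0 i ^+ 2.
Proof.
rewrite -powR_mulrn ?lpnorm_ge0// lpnorm_powR//.
apply: eq_bigr => i _; rewrite powR_mulrn//.
by rewrite real_normK ?num_real.
Qed.

End Duality.

Section BallIndicator.
Variable R : realType.

Lemma ball_ind_ge0 n (p : \bar R) z : 0 <= @ball_ind R n p z.
Proof. by rewrite /ball_ind indicE. Qed.

Lemma ball_ind_vflip n (p : \bar R) i z : (1 <= p)%E ->
  ball_ind p (vflip i z) = @ball_ind R n p z.
Proof.
have nf k : `|vflip i z k| = `|z k|.
  by rewrite /vflip; case: eqP; rewrite ?normrN.
case: p => [q| |] q1; last by discriminate q1.
  rewrite !ball_ind_fin//; congr ((_ <= _)%R%:R).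
  by apply: eq_bigr => k _; rewrite nf.
by rewrite !ball_ind_inf; apply: eq_bigr => k _; rewrite nf.
Qed.

Lemma ball_ind_coord n (p : \bar R) z i : (1 <= p)%E ->
  @ball_ind R n p z != 0 -> `|z i| <= 1.
Proof.
case: p => [q| |] q1; last by discriminate q1.
  rewrite ball_ind_fin//; case: (leP (psum q z) 1) => [h _|]; last by rewrite eqxx.
  exact: psum_le1_coord h.
rewrite ball_ind_inf; apply: contraR => zi.
by rewrite (bigD1 i)//= (negbTE zi) mul0r.
Qed.

End BallIndicator.

(** * Tail bounds over the ball and comparison with the flip probability *)

Section FlipProbability.
Variables (R : realType) (n : nat) (p : \bar R).
Hypothesis p1 : (1 <= p)%E.
Local Notation b := (@ball_ind R n.+1 p).
Local Notation m := (bintegral b).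
Local Notation D := (m (fun=> 1)).
Local Notation a := (dpow n.+1 p)^-1.

Let b0 := @ball_ind_ge0 R n.+1 p.
Let mb := @rmeasurable_ball_ind R n.+1 p p1.
Let bflip : forall i z, b (vflip i z) = b z := fun i z => ball_ind_vflip i z p1.
Let bsupp : forall z, b z != 0 -> forall i, `|z i| <= 1 :=
  fun z h i => ball_ind_coord i p1 h.

Lemma dpow_gt0 : 0 < dpow n.+1 p.
Proof. by case: (p) p1 => [q| |]//= q1; rewrite powR_gt0. Qed.

Let a0 : 0 < a. Proof. by rewrite invr_gt0 dpow_gt0. Qed.

Lemma ball_mass_gt0 : 0 < D.
Proof.
by have [V V0 sb] := lpball_slice_bounds n p1; exact: (bmass_gt0 b0 mb a0 V0 sb).
Qed.

Lemma volE (A : set 'rV[R]_n.+1) :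
  vol (@lpball R n.+1 p `&` A) = iint (fun z => (b z * \1_A (\row_i z i))%:E).
Proof. by congr iint; apply/funext => z; rewrite indicI. Qed.

Lemma vol_ballE : vol (@lpball R n.+1 p) = D%:E.
Proof.
have [V V0 sb] := lpball_slice_bounds n p1.
rewrite -(bintegralE b0 mb a0 V0 sb)//; last exact: bmeasurable_cst.
by congr iint; apply/funext => z; rewrite mulr1.
Qed.

Lemma ball_chebyshev (u : 'I_n.+1 -> R) (t : R) : 0 < t ->
  m (fun z => (t <= `|lform u (index_enum 'I_n.+1) z|)%R%:R) / D <=
    (moment4_cst R + 1) / 2 * a ^+ 2 * (\sum_i u i ^+ 2) / t ^+ 2.
Proof.
move=> t0; have [V V0 sb] := lpball_slice_bounds n p1.
rewrite ler_pdivrMr ?ball_mass_gt0//.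
exact: (chebyshev_lform b0 mb bflip bsupp a0 V0 sb).
Qed.

Lemma ball_paley_zygmund (u : 'I_n.+1 -> R) (theta delta : R) :
  0 <= theta -> 0 < delta -> 0 < \sum_i u i ^+ 2 ->
  theta + delta <= moment2_cst R * a ^+ 2 * (\sum_i u i ^+ 2) ->
  delta ^+ 2 / (3 * moment4_cst R * a ^+ 4 * (\sum_i u i ^+ 2) ^+ 2) <=
  m (fun z => (theta < lform u (index_enum 'I_n.+1) z ^+ 2)%R%:R) / D.
Proof.
move=> th0 d0 U0 td; have [V V0 sb] := lpball_slice_bounds n p1.
rewrite ler_pdivlMr ?ball_mass_gt0//.
exact: (paley_zygmund_lform b0 mb bflip bsupp a0 V0 sb).
Qed.

Variables (L : nat) (g : 'rV[R]_n.+1 -> 'I_L) (x : 'rV[R]_n.+1) (alpha : R).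

Let E := [set v | g (x + alpha *: v) != g x].

(** Finiteness comes from monotonicity against the whole ball, because the event [E] may fail to be
    measurable. *)
Let vol_fin : vol (@lpball R n.+1 p `&` E) \is a fin_num.
Proof.
rewrite ge0_fin_numE; last by rewrite volE; apply: iint_ge0 => z; rewrite lee_fin mulr_ge0// indicE.
rewrite (@le_lt_trans _ _ D%:E)// ?ltry// -vol_ballE volE.
apply: le_iint => z; rewrite lee_fin; first by rewrite mulr_ge0// indicE.
by rewrite ler_piMr// indicE lern1 leq_b1.
Qed.

(** The majorant [F] need not be an indicator, so that the sum of indicators in a union bound can be
    used directly. *)
Lemma flip_prob_le (F : ('I_n.+1 -> R) -> R) : bmeasurable b F -> (forall z, 0 <= F z) ->
  (forall v : 'rV_n.+1, g (x + alpha *: v) != g x -> 1 <= F (v ord0)) ->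
  flip_prob p g x alpha <= m F / D.
Proof.
move=> mF F0 EF; have [V V0 sb] := lpball_slice_bounds n p1.
rewrite /flip_prob vol_ballE /= ler_pM2r ?invr_gt0 ?ball_mass_gt0//.
rewrite -lee_fin fineK// -(bintegralE b0 mb a0 V0 sb)// volE.
apply: le_iint => z; rewrite lee_fin; first by rewrite mulr_ge0// indicE.
rewrite ler_wpM2l// indicE; case: (boolP (_ \in _)) => [|_]//.
rewrite inE => /EF /le_trans; apply; rewrite le_eqVlt; apply/orP; left; apply/eqP.
by congr F; apply/funext => i; rewrite mxE.
Qed.

Lemma flip_prob_ge (P : ('I_n.+1 -> R) -> bool) : rmeasurable (fun z => (P z)%:R) ->
  (forall v : 'rV_n.+1, P (v ord0) -> g (x + alpha *: v) != g x) ->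
  m (fun z => (P z)%:R) / D <= flip_prob p g x alpha.
Proof.
move=> mP PE; have [V V0 sb] := lpball_slice_bounds n p1.
rewrite /flip_prob vol_ballE /= ler_pM2r ?invr_gt0 ?ball_mass_gt0//.
rewrite -lee_fin -(bintegralE b0 mb a0 V0 sb)//; last exact: bmeasurable_bool.
rewrite fineK// volE.
apply: le_iint => z; rewrite lee_fin; first by rewrite mulr_ge0.
rewrite ler_wpM2l//; case: (boolP (P z)) => // Pz.
rewrite indicE mem_set//=; apply: PE.
by rewrite (_ : (\row_i z i) ord0 = z)//; apply/funext => i; rewrite mxE.
Qed.

End FlipProbability.

(** * Margins of the classifier and the minimal perturbation *)

Section Classifier.
Variables (R : realType) (d L : nat).
Variables (w : 'I_L -> 'rV[R]_d) (b : 'I_L -> R) (g : 'rV[R]_d -> 'I_L).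
Variable (x : 'rV[R]_d).
Hypothesis gP : is_argmax_label w b g.
Local Notation k := (g x).

Definition margin l : R := lin_f w b k x - lin_f w b l x.

Lemma margin_shift l r :
  lin_f w b k (x + r) - lin_f w b l (x + r) = margin l + dotp (w k - w l) r.
Proof.
rewrite /margin /lin_f /dotp.
have e i : \sum_j w i ord0 j * (x + r) ord0 j = \sum_j w i ord0 j * x ord0 j + \sum_j w i ord0 j * r ord0 j.
  by rewrite -big_split; apply: eq_bigr => j _; rewrite mxE mulrDr.
rewrite !e.
have -> : \sum_i (w k - w l) ord0 i * r ord0 i = \sum_i w k ord0 i * r ord0 i - \sum_i w l ord0 i * r ord0 i.
  by rewrite -sumrB; apply: eq_bigr => j _; rewrite !mxE mulrBl.
ring.
Qed.

(** The inequality must be strict, since a tie may be resolved in favour of the original label. For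
    the same reason the converse [margin_of_flip] yields only a weak inequality. *)
Lemma flip_of_margin l r : margin l + dotp (w k - w l) r < 0 -> g (x + r) != k.
Proof.
rewrite -margin_shift subr_lt0 => h; apply/negP => /eqP gk.
by have := gP (x + r) l; rewrite gk leNgt h.
Qed.

Lemma margin_of_flip r : g (x + r) != k ->
  exists2 l, l != k & margin l + dotp (w k - w l) r <= 0.
Proof.
by move=> h; exists (g (x + r)) => //; rewrite -margin_shift subr_le0; exact: gP.
Qed.

(** Moving against the extremal vector of [w k - w l] just past the hyperplane where classes [k] and
    [l] tie changes the label, so minimality bounds the norm of [rstar]. The overshoot [e] is there
    because the tie itself need not change the label; it tends to zero. *)
Lemma min_pert_le_margin p p' rstar l : (1 <= p)%E -> (1 <= p')%E -> conj_exp p p' ->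
  w l != w k -> is_min_pert p g x rstar ->
  lpnorm p' (w k - w l) * lpnorm p rstar <= margin l.
Proof.
move=> p1 p'1 cj wl [_ rmin].
have u0 : w k - w l != 0 by rewrite subr_eq0 eq_sym.
have N0 := lpnorm_gt0 p'1 u0.
have [r ur r1] := dotp_attained p1 p'1 cj u0.
have m0 : 0 <= margin l by rewrite /margin subr_ge0; exact: gP.
apply/ler_addgt0Pr => e e0; rewrite mulrC -ler_pdivlMr//.
have c0 : 0 <= (margin l + e) / lpnorm p' (w k - w l) by rewrite divr_ge0// ?ltW// ltr_wpDl.
apply: (@le_trans _ _ (lpnorm p (- ((margin l + e) / lpnorm p' (w k - w l)) *: r))).
  apply: rmin; apply: (@flip_of_margin l); rewrite dotpZr ur mulNr divfK ?gt_eqF//.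
  by rewrite opprD addrA subrr add0r oppr_lt0.
by rewrite lpnormZ// normrN ger0_norm// ler_piMr.
Qed.

Lemma margin_le_boundary p p' rstar j : (1 <= p)%E -> (1 <= p')%E -> conj_exp p p' ->
  on_boundary w b k j (x + rstar) ->
  margin j <= lpnorm p' (w k - w j) * lpnorm p rstar.
Proof.
move=> p1 p'1 cj [e _].
have h : margin j + dotp (w k - w j) rstar = 0 by rewrite -margin_shift e subrr.
apply: le_trans (dotp_le _ _ p1 p'1 cj).
by rewrite -normrN; apply: le_trans (ler_norm _); move: h; lra.
Qed.

End Classifier.

(** * Lower and upper bounds on the robustness radius *)

Section Robustness.
Variables (R : realType) (n L : nat) (p p' : \bar R).
Variables (w : 'I_L -> 'rV[R]_n.+1) (b : 'I_L -> R) (g : 'rV[R]_n.+1 -> 'I_L).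
Variables (x rstar : 'rV[R]_n.+1).
Hypotheses (p1 : (1 <= p)%E) (p'1 : (1 <= p')%E) (cj : conj_exp p p').
Hypothesis gP : is_argmax_label w b g.
Hypothesis wne : forall l, l != g x -> w l != w (g x).
Hypothesis rmin : is_min_pert p g x rstar.
Hypothesis r0 : 0 < lpnorm p rstar.

Local Notation k := (g x).
Local Notation u l := (w k - w l).
Local Notation nrm2 l := (lpnorm 2%:E (u l)).
Local Notation dp := (dpow n.+1 p).
Local Notation rs := (lpnorm p rstar).
Local Notation C4 := (moment4_cst R).

Lemma diff_norm_gt0 q l : (1 <= q)%E -> l != k -> 0 < lpnorm q (u l).
Proof. by move=> q1 lk; apply: lpnorm_gt0 => //; rewrite subr_eq0 eq_sym wne. Qed.

Lemma le12 : (1 <= 2%:E :> \bar R)%E.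
Proof. by rewrite lee_fin ler1n. Qed.

Lemma dotpE l v : dotp (u l) v = lform ((u l) ord0) (index_enum 'I_n.+1) (v ord0).
Proof. by []. Qed.

(** By contraposition: if [|alpha|] is below the bound [T], Chebyshev limits the probability of
    crossing towards each class [l] to a quarter of [eps/(L-1)], and the union bound over [L - 1]
    classes gives less than [eps]. *)
Lemma robust_radius_ge (j' : 'I_L) (eps alpha : R) :
  (2 <= L)%N -> j' != k ->
  (forall l, l != k -> wratio p' w k j' <= wratio p' w k l) -> 0 < eps ->
  eps <= flip_prob p g x alpha ->
  (2 * Num.sqrt ((C4 + 1) / 2))^-1 * Num.sqrt (eps / (L - 1)%:R) * dp * wratio p' w k j' * rs
    <= `|alpha|.
Proof.
move=> L2 j'k hj' e0; apply: contraTT; rewrite -!ltNge.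
have dp0 := dpow_gt0 n p1.
have C20 : 0 < (C4 + 1) / 2 by rewrite divr_gt0// addr_gt0// moment4_cst_gt0.
set C2 := (C4 + 1) / 2 in C20 *; set C := (2 * _)^-1.
have C0 : 0 < C by rewrite invr_gt0 mulr_gt0// sqrtr_gt0.
(* The factor [2] in the definition of [C] produces this quarter, which makes the final comparison
   with [eps] strict. *)
have CC : C2 * C ^+ 2 = 4^-1.
  rewrite /C exprVn exprMn sqr_sqrtr ?(ltW C20)//; field; rewrite gt_eqF//.
have L10 : 0 < (L - 1)%:R :> R by rewrite ltr0n subn_gt0.
set e' := eps / _; have e'0 : 0 < e' by rewrite divr_gt0.
have ratio0 : 0 < wratio p' w k j' by rewrite divr_gt0// diff_norm_gt0// le12.
set T := _ * rs => aT.
have se0 : 0 < Num.sqrt e' by rewrite sqrtr_gt0.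
have T0 : 0 < T := mulr_gt0 (mulr_gt0 (mulr_gt0 (mulr_gt0 C0 se0) dp0) ratio0) r0.
pose ul l := (u l) ord0.
have mar l : l != k -> lpnorm p' (u l) * rs <= margin w b g x l.
  by move=> lk; apply: min_pert_le_margin => //; exact: wne.
have mar0 l : l != k -> 0 < margin w b g x l.
  by move=> lk; apply: lt_le_trans (mar l lk); rewrite mulr_gt0// diff_norm_gt0.
(* Dividing the margin by [T] instead of [|alpha|] avoids a separate case [alpha = 0]; as
   [|alpha| < T], a flip towards [l] still forces this event. *)
pose F l z : R := (margin w b g x l / T <= `|lform (ul l) (index_enum 'I_n.+1) z|)%R%:R.
have bsupp := fun z h i => @ball_ind_coord R n.+1 p z i p1 h.
have mF l : bmeasurable (@ball_ind R n.+1 p) (F l).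
  apply: bmeasurable_bool; apply: rmeasurable_le; first exact: rmeasurable_cst.
  exact: (measurableT_comp (@normr_measurable R setT) (bmeasurable_lform bsupp _ _).1).
have F0 l z : 0 <= F l z by exact: ler0n.
apply: (@le_lt_trans _ _ (bintegral (@ball_ind R n.+1 p) (fun z => \sum_(l | l != k) F l z) /
    bintegral (@ball_ind R n.+1 p) (fun=> 1))).
  apply: flip_prob_le => //.
  - exact: bmeasurable_bigsum.
  - by move=> z; exact: sumr_ge0.
  move=> v /(margin_of_flip gP) [l lk hl].
  rewrite (bigD1 l)//= -[leLHS]addr0; apply: lerD; last exact: sumr_ge0.
  rewrite /F -dotpE; suff -> : margin w b g x l / T <= `|dotp (u l) v| by [].
  rewrite ler_pdivrMr// mulrC.
  rewrite dotpZr in hl.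
  apply: (@le_trans _ _ (`|alpha| * `|dotp (u l) v|)); last by rewrite ler_wpM2r// ltW.
  by rewrite -normrM -normrN; apply: le_trans (ler_norm _); move: hl; lra.
have [V V0 sb] := lpball_slice_bounds n p1.
rewrite (bintegral_bigsum (@ball_ind_ge0 R n.+1 p) (rmeasurable_ball_ind p1) _ V0 sb)//; last first.
  by rewrite invr_gt0.
rewrite mulr_suml.
apply: (@le_lt_trans _ _ (\sum_(l < L | l != k) e' / 4)).
  apply: ler_sum => l lk; apply: le_trans (ball_chebyshev p1 _ (divr_gt0 (mar0 l lk) T0)) _.
  rewrite -/C2 -lpnorm2_sqr.
  have N20 := diff_norm_gt0 le12 lk.
  rewrite (_ : _ / _ = C2 * (nrm2 l * T / (dp * margin w b g x l)) ^+ 2); last first.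
    by field; rewrite !gt_eqF// mar0.
  have h : nrm2 l * T / (dp * margin w b g x l) <= C * Num.sqrt e'.
    rewrite ler_pdivrMr; last by rewrite mulr_gt0// mar0.
    apply: (@le_trans _ _ (C * Num.sqrt e' * (dp * (lpnorm p' (u l) * rs)))); last first.
      by rewrite ler_wpM2l ?mulr_ge0 ?sqrtr_ge0 ?(ltW C0)// ler_wpM2l ?(ltW dp0)// mar.
    rewrite (_ : nrm2 l * T = (C * Num.sqrt e' * dp * rs) * (wratio p' w k j' * nrm2 l)); last by rewrite /T; ring.
    rewrite [leRHS](_ : _ = (C * Num.sqrt e' * dp * rs) * lpnorm p' (u l)); last by ring.
    rewrite ler_wpM2l ?mulr_ge0 ?sqrtr_ge0 ?(ltW C0) ?(ltW dp0) ?(ltW r0)//.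
    (* The minimality of the ratio at [j'] makes the bound uniform over all classes [l]. *)
    have := hj' l lk; rewrite {2}/wratio (ler_pdivlMr _ _ N20); exact.
  apply: (@le_trans _ _ (C2 * (C * Num.sqrt e') ^+ 2)).
    rewrite ler_wpM2l ?(ltW C20)// lerXn2r ?nnegrE//.
      by rewrite divr_ge0// ltW// mulr_gt0// mar0.
    by rewrite mulr_ge0 ?sqrtr_ge0 ?(ltW C0).
  by rewrite exprMn sqr_sqrtr ?(ltW e'0)// mulrA CC mulrC.
rewrite sumr_const (_ : #|_| = (L - 1)%N); last first.
  by rewrite cardC1 card_ord subn1.
rewrite -[_ *+ (L - 1)]mulr_natr mulrAC /e' divfK ?gt_eqF//.
by rewrite ltr_pdivrMr// ltr_pMr// ltr1n.
Qed.

(** Paley-Zygmund gives probability at least [2 eps] that [|X|] exceeds a threshold, [X] being the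
    linear form of [w k - w j]. Where it does, the perturbation [A v] flips the label if [X < 0] and
    [-A v] does if [X >= 0]. One of the two signs therefore reaches [eps], and either will do
    because the radius only sees [|alpha|]. *)
Lemma robust_radius_le (j : 'I_L) (eps : R) :
  j != k -> on_boundary w b k j (x + rstar) ->
  0 < eps < moment2_cst R ^+ 2 / (6 * C4) ->
  let A := (Num.sqrt (moment2_cst R - Num.sqrt (6 * C4 * eps)))^-1 * dp * wratio p' w k j * rs in
  eps <= flip_prob p g x A \/ eps <= flip_prob p g x (- A).
Proof.
move=> jk bd /andP[e0 e1] A.
have dp0 := dpow_gt0 n p1.
have C40 := moment4_cst_gt0 R; have c0 := moment2_cst_gt0 R.
have N20 := diff_norm_gt0 le12 jk.
have N0 := diff_norm_gt0 p'1 jk.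
set c := moment2_cst R in c0 e1 *; set s := Num.sqrt (6 * C4 * eps) in A *.
have c'e0 : 0 < 6 * C4 * eps by rewrite !mulr_gt0.
have s0 : 0 < s by rewrite sqrtr_gt0.
have s2 : s ^+ 2 = 6 * C4 * eps by rewrite sqr_sqrtr// ltW.
(* This is the condition [eps < c^2/c'] with [c' = 6 C4], in the form [s^2 < c^2]. *)
have sc : s < c.
  rewrite -(@ltr_pXn2r _ 2)// ?nnegrE ?(ltW s0) ?(ltW c0)// s2 mulrC.
  by move: e1; rewrite ltr_pdivlMr ?mulr_gt0.
set q := Num.sqrt (c - s) in A *.
have cs0 : 0 < c - s by rewrite subr_gt0.
have q0 : 0 < q by rewrite sqrtr_gt0.
have q2 : q ^+ 2 = c - s by rewrite sqr_sqrtr// ltW.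
have iq0 : 0 < q^-1 by rewrite invr_gt0.
have A0 : 0 < A := mulr_gt0 (mulr_gt0 (mulr_gt0 iq0 dp0) (divr_gt0 N0 N20)) r0.
have mj := margin_le_boundary p1 p'1 cj bd.
pose ul := (u j) ord0.
pose X := lform ul (index_enum 'I_n.+1).
have bsupp := fun z h i => @ball_ind_coord R n.+1 p z i p1 h.
have mX : rmeasurable X := (bmeasurable_lform bsupp _ _).1.
(* [A] is chosen so that [A] times this threshold equals the dual norm times the norm of [rstar], an
   upper bound for the margin of [j]. *)
have mar_le z : (nrm2 j * dp^-1 * q < `|X z|) -> margin w b g x j < A * `|X z|.
  move=> h; apply: (le_lt_trans mj).
  rewrite (_ : _ * rs = A * (nrm2 j * dp^-1 * q)); last first.
    by rewrite /A /wratio; field; rewrite !gt_eqF.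
  by rewrite ltr_pM2l.
pose P (e : R) z := margin w b g x j + e * A * X z < 0.
have mP e : rmeasurable (fun z => (P e z)%:R).
  apply: rmeasurable_lt; last exact: rmeasurable_cst.
  apply: rmeasurableD; first exact: rmeasurable_cst.
  by apply: rmeasurableM => //; exact: rmeasurable_cst.
have flip e : bintegral (@ball_ind R n.+1 p) (fun z => (P e z)%:R) /
    bintegral (@ball_ind R n.+1 p) (fun=> 1) <= flip_prob p g x (e * A).
  apply: flip_prob_ge => // v hv; apply: (flip_of_margin gP (l := j)).
  by rewrite dotpZr dotpE.
have U0 : 0 < \sum_i ul i ^+ 2 by rewrite -lpnorm2_sqr exprn_gt0.
(* The second-moment constant [c] is split as [(c - s) + s] into threshold and gap. Since
   [s^2 = 6 C4 eps], the resulting probability [s^2/(3 C4)] is exactly [2 eps]. *)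
have := @ball_paley_zygmund R n p p1 ul (nrm2 j ^+ 2 * (dp^-1) ^+ 2 * (c - s)) (nrm2 j ^+ 2 * (dp^-1) ^+ 2 * s).
rewrite -lpnorm2_sqr => PZ.
have {}PZ := PZ (mulr_ge0 (mulr_ge0 (sqr_ge0 _) (sqr_ge0 _)) (ltW cs0)).
have N2d : 0 < nrm2 j ^+ 2 * dp^-1 ^+ 2 by rewrite mulr_gt0 ?exprn_gt0 ?invr_gt0.
have {}PZ := PZ (mulr_gt0 N2d s0).
have {}PZ := PZ (exprn_gt0 2 N20).
have h2 : 2 * eps <= bintegral (@ball_ind R n.+1 p) (fun z => (nrm2 j ^+ 2 * (dp^-1) ^+ 2 * (c - s) < X z ^+ 2)%R%:R) /
    bintegral (@ball_ind R n.+1 p) (fun=> 1).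
  apply: le_trans (PZ _); last by rewrite -/c le_eqVlt; apply/orP; left; apply/eqP; ring.
  rewrite exprMn s2 le_eqVlt; apply/orP; left; apply/eqP.
  by field; rewrite !gt_eqF.
have [V V0 sb] := lpball_slice_bounds n p1.
have a0 : 0 < dp^-1 by rewrite invr_gt0.
have bb := @bmeasurable_bool R n (@ball_ind R n.+1 p).
have key : bintegral (@ball_ind R n.+1 p) (fun z => (nrm2 j ^+ 2 * (dp^-1) ^+ 2 * (c - s) < X z ^+ 2)%R%:R) <=
   bintegral (@ball_ind R n.+1 p) (fun z => (P 1 z)%:R) + bintegral (@ball_ind R n.+1 p) (fun z => (P (-1) z)%:R).
  have b0 := @ball_ind_ge0 R n.+1 p; have mb := rmeasurable_ball_ind (n := n.+1) p1.
  rewrite -(bintegralD b0 mb a0 V0 sb); try by [apply: bb; exact: mP|move=> z; exact: ler0n].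
  apply: (ler_bintegral b0 mb a0 V0 sb).
  - apply: bb; apply: rmeasurable_lt; first exact: rmeasurable_cst.
    exact: rmeasurableX.
  - by apply: bmeasurableD; apply: bb; exact: mP.
  - by move=> z; exact: ler0n.
  move=> z; case: (ltP _ (X z ^+ 2)) => [h|_]; last by rewrite addr_ge0.
  have /mar_le hX : nrm2 j * dp^-1 * q < `|X z|.
    rewrite -(@ltr_pXn2r _ 2)// ?nnegrE ?mulr_ge0 ?(ltW N20) ?(ltW a0) ?(ltW q0)//.
    by rewrite real_normK ?num_real// !exprMn q2.
  have [Xz|Xz] := leP 0 (X z).
    suff -> : P (- 1) z by rewrite lerDr.
    by move: hX; rewrite ger0_norm// /P => hX; lra.
  suff -> : P 1 z by rewrite lerDl.
  by move: hX; rewrite ltr0_norm// /P => hX; lra.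
have D0 := ball_mass_gt0 n p1.
have {}h2 := le_trans h2 (ler_wpM2r (ltW (_ : 0 < (bintegral (@ball_ind R n.+1 p) (fun=> 1))^-1)) key).
have := h2 _; rewrite invr_gt0 D0 mulrDl => /(_ isT) h3.
have f1 := flip 1; have f2 := flip (- 1); rewrite mul1r in f1; rewrite mulN1r in f2.
case: (leP eps (flip_prob p g x A)) => [hA|hA]; first by left.
right; move: h3 f1 f2 hA; lra.
Qed.

End Robustness.

Theorem theorem5 (R : realType) :
  exists C c c' : R, 0 < C /\ 0 < c /\ 0 < c' /\
  let eps0 := c ^+ 2 / c' in
  let zeta1 := fun delta : R => C * Num.sqrt delta in
  let zeta2 := fun delta : R => (Num.sqrt (c - Num.sqrt (c' * delta)))^-1 in
  forall (d L : nat) (p p' : \bar R) (w : 'I_L -> 'rV[R]_d) (b : 'I_L -> R)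
    (g : 'rV[R]_d -> 'I_L) (x rstar : 'rV[R]_d) (j j' : 'I_L) (eps : R),
    (1 <= d)%N -> (2 <= L)%N ->
    (1 <= p)%E -> (1 <= p')%E -> conj_exp p p' ->
    is_argmax_label w b g ->
    let k := g x in
    (forall l, l != k -> w l != w k) ->
    is_min_pert p g x rstar -> 0 < lpnorm p rstar ->
    j != k -> on_boundary w b k j (x + rstar) ->
    j' != k -> (forall l, l != k -> wratio p' w k j' <= wratio p' w k l) ->
    0 < eps < eps0 ->
    ((zeta1 (eps / (L - 1)%:R) * dpow d p * wratio p' w k j')%:E
       <= r_eps p g x eps * ((lpnorm p rstar)^-1)%:E)%E /\
    (r_eps p g x eps * ((lpnorm p rstar)^-1)%:E
       <= (zeta2 eps * dpow d p * wratio p' w k j)%:E)%E.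
Proof.
(* In the third constant [6 = 2 * 3]: the [3] comes from the fourth moment of a linear form, the [2]
   from the two signs of the perturbation. *)
exists (2 * Num.sqrt ((moment4_cst R + 1) / 2))^-1, (moment2_cst R), (6 * moment4_cst R).
have C40 := moment4_cst_gt0 R; have c0 := moment2_cst_gt0 R.
split; first by rewrite invr_gt0 mulr_gt0// sqrtr_gt0 divr_gt0// addr_gt0.
split=> //; split; first by rewrite mulr_gt0.
move=> eps0 zeta1 zeta2 [//|n] L p p' w b g x rstar j j' eps _ L2 p1 p'1 cj gP k wne rmin r0 jk bd j'k hj' he.
have ir0 : (0 <= ((lpnorm p rstar)^-1)%:E)%E by rewrite lee_fin invr_ge0 ltW.
split.
  (* Both estimates are first multiplied through by the norm of [rstar], so that they concern
     [r_eps] itself: the lower one bounds every element of the set under the infimum, the upper one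
     exhibits an element. *)
  apply: (@le_trans _ _ ((zeta1 (eps / (L - 1)%:R) * dpow n.+1 p * wratio p' w k j' * lpnorm p rstar)%:E * ((lpnorm p rstar)^-1)%:E))%E.
    by rewrite -EFinM mulfK ?gt_eqF.
  apply: lee_wpmul2r => //; apply: le_ereal_inf_tmp => _ [alpha /= ha <-].
  rewrite lee_fin; apply: robust_radius_ge ha => //.
  by case/andP: he.
apply: (@le_trans _ _ ((zeta2 eps * dpow n.+1 p * wratio p' w k j * lpnorm p rstar)%:E * ((lpnorm p rstar)^-1)%:E))%E; last first.
  by rewrite -EFinM mulfK ?gt_eqF.
apply: lee_wpmul2r => //.
have A0 : 0 <= zeta2 eps * dpow n.+1 p * wratio p' w k j * lpnorm p rstar.
  by rewrite !mulr_ge0 ?invr_ge0 ?sqrtr_ge0 ?lpnorm_ge0// ?(ltW (dpow_gt0 _ _)).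
have [h|h] := robust_radius_le p1 p'1 cj gP wne r0 jk bd he.
  by apply: ereal_inf_lbound; eexists; [exact: h|rewrite ger0_norm].
by apply: ereal_inf_lbound; eexists; [exact: h|rewrite normrN ger0_norm].
Qed.
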